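(* Let $k$ be an odd integer, $U$ a graded space, $B$ a graded commutative unitary algebra, and let $\Delta$ and $\Delta'$ be degree $k$ derived $BV$ algebra structures on $S(U)$ (with the symmetric product) and on $B$ respectively. Let $\varphi\in\operatorname{Hom}^0(S(U),B[[t]])$ be such that $\varphi(\mathbf{1}_{S(U)})=0$. Then $\varphi$ defines a morphism of derived $BV$ algebras in the sense of Cieliebak and Latschev if and only if $\exp_\star(\varphi)$ defines a morphism of derived $BV$ algebras from $(S(U),\Delta)$ to $(B,\Delta')$.
   Context: $\mathbb{K}$ is a field of characteristic zero; spaces are $\mathbb{Z}$-graded, algebras are graded commutative and unitary, $\pm_K$ denotes Koszul signs. $t$ is a central variable of (even) degree $1-k$. Koszul brackets: for $\Delta\in\operatorname{End}_u(A)$ (i.e. $\Delta(\mathbf{1}_A)=0$), $\mathcal{K}(\Delta)_n(a_1,\ldots,a_n)=\sum_{i=1}^n\sum_{\sigma\in S(i,n-i)}\pm_K(-1)^{n-i}\Delta(a_{\sigma(1)}\cdots a_{\sigma(i)})a_{\sigma(i+1)}\cdots a_{\sigma(n)}$, with $S(i,n-i)$ the $(i,n-i)$-unshuffles. Cumulants: for a degree zero $f:A\to B$ with $f(\mathbf{1}_A)=\mathbf{1}_B$, $\kappa(f)_n(a_1,\ldots,a_n)=\sum_{k=1}^n\sum_{I_1\sqcup\cdots\sqcup I_k=\{1,\ldots,n\}}(-1)^{k-1}(k-1)!\pm_K\prod_{j=1}^kf(\prod_{i\in I_j}a_i)$, summed over unordered partitions into nonempty subsets. Both are applied $\mathbb{K}[[t]]$-linearly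 to $A[[t]]$, $B[[t]]$. Degree $k$ derived $BV$ algebra: a graded commutative unitary algebra $A$ with a degree one $\mathbb{K}[[t]]$-linear map $\Delta=\sum_{n\ge0}t^n\Delta_n$ on $A[[t]]$, $\Delta_n\in\operatorname{End}_u(A)$, $|\Delta_n|=1+n(k-1)$, such that $\Delta^2=0$ and $\mathcal{K}(\Delta)_n(a_1,\ldots,a_n)\equiv0\pmod{t^{n-1}}$ for all $n\ge2$, $a_i\in A$. Morphism of derived $BV$ algebras $(A,\Delta)\to(B,\Delta')$: a degree zero $\mathbb{K}[[t]]$-linear map $f:A[[t]]\to B[[t]]$ with $f(\mathbf{1}_A)=\mathbf{1}_B$, $f\circ\Delta=\Delta'\circ f$ and $\kappa(f)_n(a_1,\ldots,a_n)\equiv0\pmod{t^{n-1}}$ for all $n\ge2$, $a_i\in A$. Convolution: $\operatorname{Hom}(S(U),B[[t]])$ is a unitary graded commutative algebra under $F\star G=\mu\circ(F\otimes G)\circ\Delta_{S(U)}$, where $\Delta_{S(U)}$ is the unshuffle coproduct on $S(U)$ and $\mu$ the product of $B[[t]]$; the unit $\varepsilon$ sends $\mathbf{1}_{S(U)}$ to $\mathbf{1}_B$ and $U^{\odot n}$ to $0$ for $n\ge1$. For $\varphi$ with $\varphi(\mathbf{1}_{S(U)})=0$, $\exp_\star(\varphi)=\varepsilon+\sum_{m\ge1}\frac{1}{m!}\varphi^{\star m}$; its $\mathbb{K}[[t]]$-linear extension $S(U)[[t]]\to B[[t]]$ is denoted in the same way. Morphism in the sense of Cieliebak and Latschev: a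 map $\varphi\in\operatorname{Hom}^0(S(U),B[[t]])$ with $\varphi(\mathbf{1}_{S(U)})=0$ such that (i) $\exp_\star(\varphi)\circ\Delta=\Delta'\circ\exp_\star(\varphi)$, and (ii) writing $\varphi=\sum_{n\ge0}t^n\varphi_n$ with $\varphi_n:S(U)\to B$, the map $\varphi_n$ vanishes on $\bigoplus_{i\ge n+2}U^{\odot i}$ for all $n\ge0$. *)

(* Defs.v *)
From HB Require Import structures.
From mathcomp Require Import all_boot all_order all_algebra perm.
From mathcomp Require Import boolp.
From mathcomp Require Import finmap monalg zify.

Set Implicit Arguments.
Unset Strict Implicit.
Unset Printing Implicit Defensive.

Import GRing.Theory.
Local Open Scope ring_scope.

(* [x n] is the coefficient of t^n in [x].                                   *)

Definition pser (A : Type) : Type := nat -> A.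

HB.instance Definition _ (A : Type) := gen_eqMixin (pser A).
HB.instance Definition _ (A : Type) := gen_choiceMixin (pser A).

Section PserZmodule.
Variable A : zmodType.
Implicit Types x y z : pser A.

Definition pser_add x y : pser A := fun n => x n + y n.
Definition pser_opp x : pser A := fun n => - x n.

Fact pser_addA : associative pser_add.
Proof. by move=> x y z; apply/funext => n; exact: addrA. Qed.
Fact pser_addC : commutative pser_add.
Proof. by move=> x y; apply/funext => n; exact: addrC. Qed.
Fact pser_add0 : left_id (fun=> 0 : A) pser_add.
Proof. by move=> x; apply/funext => n; exact: add0r. Qed.
Fact pser_addN : left_inverse (fun=> 0 : A) pser_opp pser_add.
Proof. by move=> x; apply/funext => n; exact: addNr. Qed.

HB.instance Definition _ :=
  GRing.isZmodule.Build (pser A) pser_addA pser_addC pser_add0 pser_addN.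

Lemma pserD x y n : (x + y) n = x n + y n. Proof. by []. Qed.
Lemma pser0 n : (0 : pser A) n = 0. Proof. by []. Qed.
Lemma pserN x n : (- x) n = - x n. Proof. by []. Qed.

Lemma pser_sum (I : Type) (r : seq I) (P : pred I) (F : I -> pser A) n :
  (\sum_(i <- r | P i) F i) n = \sum_(i <- r | P i) F i n.
Proof. by elim/big_rec2: _ => [|i _ y _ <-]. Qed.

Definition pconst (a : A) : pser A := fun n => if n is 0 then a else 0.
End PserZmodule.

Section PserLmodule.
Variables (K : pzRingType) (A : lmodType K).
Implicit Types (x y : pser A) (c : K).

Definition pser_scal c x : pser A := fun n => c *: x n.

Fact pser_scalA c d x : pser_scal c (pser_scal d x) = pser_scal (c * d) x.
Proof. by apply/funext => n; exact: scalerA. Qed.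
Fact pser_scal1 : left_id 1 pser_scal.
Proof. by move=> x; apply/funext => n; exact: scale1r. Qed.
Fact pser_scalDr : right_distributive pser_scal +%R.
Proof. by move=> c x y; apply/funext => n; exact: scalerDr. Qed.
Fact pser_scalDl x : {morph pser_scal^~ x : c d / c + d}.
Proof. by move=> c d; apply/funext => n; exact: scalerDl. Qed.

HB.instance Definition _ := GRing.Zmodule_isLmodule.Build K (pser A)
  pser_scalA pser_scal1 pser_scalDr pser_scalDl.

Lemma pserZ c x n : (c *: x) n = c *: x n. Proof. by []. Qed.

Definition tscale (c : pser K) (x : pser A) : pser A :=
  fun n => \sum_(i < n.+1) c i *: x (n - i)%N.
End PserLmodule.

Section PserRing.
Variable A : pzRingType.
Implicit Types x y z : pser A.

Definition pser_mul x y : pser A := fun n => \sum_(i < n.+1) x i * y (n - i)%N.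

Fact pser_mulA : associative pser_mul.
Proof.
move=> x y z; apply/funext => n; rewrite /pser_mul.
have rev (u v : nat -> A) m : \sum_(i < m.+1) u i * v (m - i)%N =
                 \sum_(i < m.+1) u (m - i)%N * v i :> A.
  rewrite (reindex_inj rev_ord_inj) /=.
  by apply: eq_bigr => i _; rewrite subSS subKn // -ltnS.
transitivity (\sum_(i < n.+1) \sum_(j < n.+1 | (j <= n - i)%N)
                x i * (y (n - i - j)%N * z j)).
  apply: eq_bigr => i _; rewrite rev big_distrr /=.
  rewrite (big_ord_narrow_leq (leq_subr i n)).
  by apply: eq_bigr => j _.
transitivity (\sum_(j < n.+1) \sum_(i < n.+1 | (i <= n - j)%N)
                x i * (y (n - i - j)%N * z j)).
  rewrite (exchange_big_dep predT) //=; apply: eq_bigr => j _.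
  apply: eq_bigl => i; rewrite !leq_subRL -1?ltnS //; first by rewrite addnC.
rewrite [RHS](rev (pser_mul x y) z) /pser_mul; apply: eq_bigr => j _.
rewrite (big_ord_narrow_leq (leq_subr j n)) big_distrl /=.
by apply: eq_bigr => i _; rewrite mulrA -!subnDA addnC.
Qed.

Fact pser_mul1 : left_id (pconst (1 : A)) pser_mul.
Proof.
move=> x; apply/funext => n; rewrite /pser_mul big_ord_recl subn0 mul1r.
by rewrite big1 ?addr0 // => i _; exact: mul0r.
Qed.

Fact pser_mulr1 : right_id (pconst (1 : A)) pser_mul.
Proof.
move=> x; apply/funext => n; rewrite /pser_mul big_ord_recr subnn mulr1.
rewrite big1 => [|i _]; first exact: add0r.
by rewrite /pconst; case E: (n - i)%N (ltn_ord i) => [|m]; rewrite ?mulr0 // -subn_gt0 E.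
Qed.

Fact pser_mulDl : left_distributive pser_mul +%R.
Proof.
move=> x y z; apply/funext => n; rewrite pserD /pser_mul -big_split.
by apply: eq_bigr => i _; exact: mulrDl.
Qed.

Fact pser_mulDr : right_distributive pser_mul +%R.
Proof.
move=> x y z; apply/funext => n; rewrite pserD /pser_mul -big_split.
by apply: eq_bigr => i _; exact: mulrDr.
Qed.

HB.instance Definition _ := GRing.Zmodule_isPzRing.Build (pser A)
  pser_mulA pser_mul1 pser_mulr1 pser_mulDl pser_mulDr.

Lemma pserM x y n : (x * y) n = \sum_(i < n.+1) x i * y (n - i)%N.
Proof. by []. Qed.
End PserRing.

(* Graded commutative unitary algebras, with the zero algebra allowed.  The   *)
(* hierarchy has no join of [lmodType] and [pzRingType] (an [algType] has     *)
(* 1 != 0), hence the product is part of the mixin and the ring structure is  *)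
(* derived from it.                                                           *)

Definition oddz (d : int) : bool := odd `|d|%N.

HB.mixin Record isGCAlgebra (K : fieldType) (A : Type) of GRing.Lmodule K A := {
  gc_one : A;
  gc_mul : A -> A -> A;
  gc_mulA : associative gc_mul;
  gc_mul1 : left_id gc_one gc_mul;
  gc_mulr1 : right_id gc_one gc_mul;
  gc_mulDl : left_distributive gc_mul +%R;
  gc_mulDr : right_distributive gc_mul +%R;
  gc_scalerAl : forall (c : K) x y, c *: gc_mul x y = gc_mul (c *: x) y;
  gc_scalerAr : forall (c : K) x y, c *: gc_mul x y = gc_mul x (c *: y);
  homog : int -> A -> Prop;
  homog0 : forall d, homog d 0;
  homogP : forall d (c : K) x y, homog d x -> homog d y -> homog d (c *: x + y);
  homog_sum : forall x, exists (n : nat) (d : 'I_n -> int) (y : 'I_n -> A),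
    (forall i, homog (d i) (y i)) /\ x = \sum_i y i;
  homog_indep : forall (D : seq int) (y : int -> A), uniq D ->
    (forall d, homog d (y d)) -> \sum_(d <- D) y d = 0 ->
    forall d, d \in D -> y d = 0;
  homog1 : homog 0 gc_one;
  homog_mul : forall d e x y, homog d x -> homog e y -> homog (d + e) (gc_mul x y);
  homog_comm : forall d e x y, homog d x -> homog e y ->
    gc_mul x y = (-1) ^+ (oddz d && oddz e) *: gc_mul y x
}.

#[short(type="gcalgType")]
HB.structure Definition GCAlgebra (K : fieldType) :=
  {A of GRing.Lmodule K A & isGCAlgebra K A}.

HB.instance Definition _ (K : fieldType) (A : gcalgType K) :=
  GRing.Zmodule_isPzRing.Build (GCAlgebra.sort A)
    (@gc_mulA K A) (@gc_mul1 K A) (@gc_mulr1 K A) (@gc_mulDl K A) (@gc_mulDr K A).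

Section GCAlgebraTheory.
Variables (K : fieldType) (A : gcalgType K).
Implicit Types (c : K) (x y : A).

Lemma gcZAl c x y : c *: (x * y) = (c *: x) * y. Proof. exact: gc_scalerAl. Qed.
Lemma gcZAr c x y : c *: (x * y) = x * (c *: y). Proof. exact: gc_scalerAr. Qed.
Lemma homogM d e x y : homog d x -> homog e y -> homog (d + e) (x * y).
Proof. exact: homog_mul. Qed.
Lemma homogC d e x y : homog d x -> homog e y ->
  x * y = (-1) ^+ (oddz d && oddz e) * (y * x).
Proof.
by move=> hx hy; rewrite [x * y](homog_comm _ _ _ _ hx hy); case: (_ && _);
   rewrite ?expr1 ?expr0 ?scaleN1r ?scale1r ?mulN1r ?mul1r.
Qed.
End GCAlgebraTheory.

(* Parity exponent of the Koszul sign relating a_1 ... a_n to the product of *)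
(* the a_i taken in the order prescribed by [s], where |a_i| = d i.          *)
Fixpoint kparity n (d : 'I_n -> int) (s : seq 'I_n) : nat :=
  if s is i :: s' then
    (count (fun j : 'I_n => [&& (j < i)%N, oddz (d i) & oddz (d j)]) s'
       + kparity d s')%N
  else 0%N.

(* S(i, n - i), as permutations of {0, ..., n-1}. *)
Definition unshuffle n (i : nat) (s : 'S_n) : bool :=
  [forall p : 'I_n, forall q : 'I_n,
    (p < q)%N && ((q < i)%N || (i <= p)%N) ==> (s p < s q)%N].

Definition koszul_bracket (R : pzRingType) (D : R -> R) n (d : 'I_n -> int)
    (a : 'I_n -> R) : R :=
  \sum_(1 <= i < n.+1) \sum_(s : 'S_n | unshuffle i s)
    (-1) ^+ (kparity d (codom s) + (n - i)) *
      (D (\prod_(j < n | (j < i)%N) a (s j)) * \prod_(j < n | (i <= j)%N) a (s j)).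

(* The blocks of a partition P are taken in the order [enum P]; the summand *)
(* does not depend on this order when the a_i are homogeneous of degree d i *)
(* and f has degree zero.                                                   *)
Definition cumulant (R R' : pzRingType) (f : R -> R') n (d : 'I_n -> int)
    (a : 'I_n -> R) : R' :=
  \sum_(P : {set {set 'I_n}} | partition P [set: 'I_n])
    (-1) ^+ (#|P|.-1 + kparity d (flatten [seq enum X | X : {set 'I_n} <- enum P])) *
      (\prod_(X <- enum P) f (\prod_(i in X) a i)) *+ (#|P|.-1)`!.

Section PserMaps.
Variable K : fieldType.

Definition tlinear (A B : lmodType K) (f : pser A -> pser B) : Prop :=
  forall (c : pser K^o) (x y : pser A),
    f (tscale c x + y) = tscale c (f x) + f y.

Definition tcoef (A B : zmodType) (f : pser A -> pser B) (n : nat) (a : A) : B :=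
  f (pconst a) n.

(* The extension to A[[t]] of a map A -> B[[t]]. *)
Definition text (A B : zmodType) (f : A -> pser B) (x : pser A) : pser B :=
  fun n => \sum_(i < n.+1) f (x i) (n - i)%N.

(* t has degree 1 - k. *)
Definition pser_homog (k : int) (A : gcalgType K) (d : int) (x : pser A) : Prop :=
  forall n : nat, homog (d + n%:Z * (k - 1)) (x n).

Definition tmod0 (A : zmodType) (m : nat) (x : pser A) : Prop :=
  forall i : nat, (i < m)%N -> x i = 0.

Let tX (i : nat) : pser K^o := fun n => (n == i)%:R.

Let tscaleX (A : lmodType K) i (x : pser A) n :
  tscale (tX i) x n = if (i <= n)%N then x (n - i)%N else 0.
Proof.
rewrite /tscale; case: ifP => [le_in|lt_ni].
  rewrite (bigD1 (Ordinal (le_in : (i < n.+1)%N))) //= /tX eqxx scale1r.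
  rewrite big1 ?addr0 // => j /eqP neq; case: eqP => [E|_]; last exact: scale0r.
  by case: neq; apply: val_inj.
rewrite big1 // => j _; rewrite /tX; case: eqP => [E|_]; last exact: scale0r.
by move: (ltn_ord j); rewrite E ltnS lt_ni.
Qed.

(* A K[[t]]-linear map is the sum of the t^n (tcoef f n). *)
Lemma tlinearE (A B : lmodType K) (f : pser A -> pser B) :
  tlinear f -> f = text (fun a n => tcoef f n a).
Proof.
move=> flin; apply/funext => x; apply/funext => n.
pose tail m : pser A := fun i => x (i + m)%N.
have step m : tail m = tscale (tX 1) (tail m.+1) + pconst (x m).
  apply/funext => i; rewrite pserD tscaleX /tail /pconst.
  by case: i => [|i] /=; rewrite ?add0r // addr0 subn1 addnS.
have fstep m i : f (tail m) i =
    (if i is j.+1 then f (tail m.+1) j else 0) + tcoef f i (x m).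
  rewrite {1}step flin pserD tscaleX; case: i => [|i] //=.
  by rewrite subn1.
have : forall m i, f (tail m) i = \sum_(j < i.+1) tcoef f (i - j)%N (x (j + m)%N).
  move=> m i; elim: i m => [|i IH] m; rewrite fstep.
    by rewrite big_ord1 add0r.
  rewrite IH [RHS]big_ord_recl addrC; congr (_ + _).
  by apply: eq_bigr => j _; rewrite addnS.
move/(_ 0%N n) => E.
transitivity (f (tail 0%N) n).
  by congr (f _ _); apply/funext => i; rewrite /tail addn0.
by rewrite E; apply: eq_bigr => j _; rewrite addn0.
Qed.
End PserMaps.

Record derivedBV (K : fieldType) (k : int) (A : gcalgType K) := DerivedBV {
  bvop :> pser A -> pser A;
  bv_tlinear : tlinear bvop;
  bv_unit : forall n, tcoef bvop n 1 = 0;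
  bv_degree : forall (n : nat) d (a : A),
    homog d a -> homog (d + (1 + n%:Z * (k - 1))) (tcoef bvop n a);
  bv_square : forall x, bvop (bvop x) = 0;
  bv_koszul : forall (n : nat) (d : 'I_n -> int) (a : 'I_n -> A), (2 <= n)%N ->
    (forall i, homog (d i) (a i)) ->
    tmod0 n.-1 (koszul_bracket bvop d (fun i => pconst (a i)))
}.

Definition BV_morphism (K : fieldType) (k : int) (A B : gcalgType K)
    (DA : derivedBV k A) (DB : derivedBV k B) (f : pser A -> pser B) : Prop :=
  [/\ tlinear f,
      (forall d x, pser_homog k d x -> pser_homog k d (f x)),
      f 1 = 1,
      (forall x, f (DA x) = DB (f x)) &
      forall (n : nat) (d : 'I_n -> int) (a : 'I_n -> A), (2 <= n)%N ->
        (forall i, homog (d i) (a i)) ->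
        tmod0 n.-1 (cumulant f d (fun i => pconst (a i)))].

(* The two-sided ideal generated by [gen].                                   *)

Inductive ideal_of (K : fieldType) (T : algType K) (gen : T -> Prop) : T -> Prop :=
| ideal_gen x : gen x -> ideal_of gen x
| ideal0 : ideal_of gen 0
| idealD x y : ideal_of gen x -> ideal_of gen y -> ideal_of gen (x + y)
| idealM a x b : ideal_of gen x -> ideal_of gen (a * x * b).

Section AlgQuotient.
Variables (K : fieldType) (T : algType K) (gen : T -> Prop).
Local Notation I := (ideal_of gen).

Lemma idealN x : I x -> I (- x).
Proof. by move=> /(idealM (-1) 1); rewrite mulr1 mulN1r. Qed.

Lemma idealZ c x : I x -> I (c *: x).
Proof. by move=> /(idealM c%:A 1); rewrite mulr1 -scalerAl mul1r. Qed.

Definition ideal_equiv (x y : T) : bool := `[< I (x - y) >].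

Fact ideal_equiv_refl : reflexive ideal_equiv.
Proof. by move=> x; apply/asboolP; rewrite subrr; exact: ideal0. Qed.
Fact ideal_equiv_sym : symmetric ideal_equiv.
Proof.
have sub x y : ideal_equiv x y -> ideal_equiv y x.
  by move=> /asboolP /idealN h; apply/asboolP; rewrite -opprB.
by move=> x y; apply/idP/idP; exact: sub.
Qed.
Fact ideal_equiv_trans : transitive ideal_equiv.
Proof.
move=> y x z /asboolP hxy /asboolP hyz; apply/asboolP.
by have := idealD hxy hyz; rewrite addrA subrK.
Qed.

Canonical ideal_equiv_equiv :=
  EquivRel ideal_equiv ideal_equiv_refl ideal_equiv_sym ideal_equiv_trans.

Definition algquot : Type := {eq_quot ideal_equiv}%qT.
HB.instance Definition _ := Choice.on algquot.
HB.instance Definition _ := EqQuotient.on algquot.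

Definition qpi (x : T) : algquot := \pi_algquot%qT x.
Definition qrepr (x : algquot) : T := repr x.

Lemma qpi_eq x y : I (x - y) -> qpi x = qpi y.
Proof. by move=> h; apply/eqmodP/asboolP. Qed.

Lemma qpi_ideal x y : qpi x = qpi y -> I (x - y).
Proof. by move=> /eqmodP/asboolP. Qed.

Lemma qreprK : cancel qrepr qpi. Proof. exact: reprK. Qed.

Lemma qrepr_pi x : I (qrepr (qpi x) - x).
Proof. by apply: qpi_ideal; rewrite qreprK. Qed.

Lemma qpiW (P : algquot -> Prop) : (forall x, P (qpi x)) -> forall x, P x.
Proof. by move=> h x; rewrite -(qreprK x). Qed.

Definition algquot_add (x y : algquot) : algquot := qpi (qrepr x + qrepr y).
Definition algquot_opp (x : algquot) : algquot := qpi (- qrepr x).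
Definition algquot_scale (c : K) (x : algquot) : algquot := qpi (c *: qrepr x).
Definition algquot_mul (x y : algquot) : algquot := qpi (qrepr x * qrepr y).

Let pi_add x y : algquot_add (qpi x) (qpi y) = qpi (x + y).
Proof. by apply: qpi_eq; rewrite opprD addrACA; apply: idealD; exact: qrepr_pi. Qed.
Let pi_opp x : algquot_opp (qpi x) = qpi (- x).
Proof. by apply: qpi_eq; rewrite -opprD; apply: idealN; exact: qrepr_pi. Qed.
Let pi_scale c x : algquot_scale c (qpi x) = qpi (c *: x).
Proof. by apply: qpi_eq; rewrite -scalerBr; apply: idealZ; exact: qrepr_pi. Qed.
Lemma qpiM x y : algquot_mul (qpi x) (qpi y) = qpi (x * y).
Proof.
apply: qpi_eq.
have -> (a b c d : T) : a * b - c * d = 1 * (a - c) * b + c * (b - d) * 1.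
  by rewrite mul1r mulr1 mulrBl mulrBr addrA subrK.
by apply: idealD; apply: idealM; exact: qrepr_pi.
Qed.

Fact algquot_addA : associative algquot_add.
Proof. by do 3!elim/qpiW=> ?; rewrite !pi_add addrA. Qed.
Fact algquot_addC : commutative algquot_add.
Proof. by do 2!elim/qpiW=> ?; rewrite !pi_add addrC. Qed.
Fact algquot_add0 : left_id (qpi 0) algquot_add.
Proof. by elim/qpiW=> ?; rewrite !pi_add add0r. Qed.
Fact algquot_addN : left_inverse (qpi 0) algquot_opp algquot_add.
Proof. by elim/qpiW=> ?; rewrite pi_opp pi_add addNr. Qed.

HB.instance Definition _ := GRing.isZmodule.Build algquot
  algquot_addA algquot_addC algquot_add0 algquot_addN.

Lemma qpiD x y : qpi (x + y) = qpi x + qpi y. Proof. by rewrite -pi_add. Qed.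

Fact algquot_scaleA c d x :
  algquot_scale c (algquot_scale d x) = algquot_scale (c * d) x.
Proof. by elim/qpiW: x => ?; rewrite !pi_scale scalerA. Qed.
Fact algquot_scale1 : left_id 1 algquot_scale.
Proof. by elim/qpiW=> ?; rewrite !pi_scale scale1r. Qed.
Fact algquot_scaleDr : right_distributive algquot_scale +%R.
Proof. by move=> c; do 2!elim/qpiW=> ?; rewrite -qpiD !pi_scale -qpiD scalerDr. Qed.
Fact algquot_scaleDl x : {morph algquot_scale^~ x : c d / c + d}.
Proof. by move=> c d /=; elim/qpiW: x => ?; rewrite !pi_scale -qpiD scalerDl. Qed.

HB.instance Definition _ := GRing.Zmodule_isLmodule.Build K algquot
  algquot_scaleA algquot_scale1 algquot_scaleDr algquot_scaleDl.

Lemma qpiZ c x : qpi (c *: x) = c *: qpi x. Proof. by rewrite -pi_scale. Qed.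

Fact qpi_linear : linear qpi.
Proof. by move=> c x y; rewrite qpiD qpiZ. Qed.

HB.instance Definition _ := GRing.isLinear.Build K T algquot _ qpi qpi_linear.

Lemma algquot_mulA : associative algquot_mul.
Proof. by do 3!elim/qpiW=> ?; rewrite !qpiM mulrA. Qed.
Lemma algquot_mul1 : left_id (qpi 1) algquot_mul.
Proof. by elim/qpiW=> ?; rewrite qpiM mul1r. Qed.
Lemma algquot_mulr1 : right_id (qpi 1) algquot_mul.
Proof. by elim/qpiW=> ?; rewrite qpiM mulr1. Qed.
Lemma algquot_mulDl : left_distributive algquot_mul +%R.
Proof. by do 3!elim/qpiW=> ?; rewrite -qpiD !qpiM -qpiD mulrDl. Qed.
Lemma algquot_mulDr : right_distributive algquot_mul +%R.
Proof. by do 3!elim/qpiW=> ?; rewrite -qpiD !qpiM -qpiD mulrDr. Qed.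
Lemma algquot_scalerAl c x y : c *: algquot_mul x y = algquot_mul (c *: x) y.
Proof.
by elim/qpiW: x => ?; elim/qpiW: y => ?; rewrite -qpiZ !qpiM -qpiZ scalerAl.
Qed.
Lemma algquot_scalerAr c x y : c *: algquot_mul x y = algquot_mul x (c *: y).
Proof.
by elim/qpiW: x => ?; elim/qpiW: y => ?; rewrite -qpiZ !qpiM -qpiZ scalerAr.
Qed.

Section Lift.
Variables (W : lmodType K) (f : {linear T -> W}).

Lemma ideal_ker : (forall a x b, gen x -> f (a * x * b) = 0) ->
  forall x, I x -> f x = 0.
Proof.
move=> fgen x Ix.
suff: forall a b, f (a * x * b) = 0 by move/(_ 1 1); rewrite mul1r mulr1.
elim: Ix => {x} [x gx a b|a b|x y _ IHx _ IHy a b|c x d _ IH a b].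
- exact: fgen.
- by rewrite mulr0 mul0r linear0.
- by rewrite mulrDr mulrDl linearD IHx IHy addr0.
- by rewrite !mulrA -(mulrA (a * c * x)); exact: IH.
Qed.

Lemma qrepr_ker : (forall a x b, gen x -> f (a * x * b) = 0) ->
  forall x, f (qrepr (qpi x)) = f x.
Proof.
by move=> fgen x; apply/eqP; rewrite -subr_eq0 -linearB; apply/eqP;
   apply: (ideal_ker fgen); exact: qrepr_pi.
Qed.
End Lift.
End AlgQuotient.

(* The free algebra on L: the words in L form a basis, with concatenation as *)
(* product.  The construction is kept opaque.                                *)

Record free_algebra (K : fieldType) (L : choiceType) := FreeAlgebra {
  freealg_ : algType K;
  tword_ : seq L -> freealg_;
  tword_nil_ : tword_ [::] = 1;
  tword_cat_ : forall w1 w2, tword_ (w1 ++ w2) = tword_ w1 * tword_ w2;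
  free_ind_ : forall P : freealg_ -> Prop, P 0 ->
    (forall c w x, P x -> P (c *: tword_ w + x)) -> forall x, P x;
  teval_ : forall W : lmodType K, (seq L -> W) -> freealg_ -> W;
  teval_linear_ : forall (W : lmodType K) (g : seq L -> W) c x y,
    teval_ g (c *: x + y) = c *: teval_ g x + teval_ g y;
  teval_word_ : forall (W : lmodType K) (g : seq L -> W) w,
    teval_ g (tword_ w) = g w
}.

Section FreeAlgebra.
Variables (K : fieldType) (L : choiceType).
Local Notation M := {malg K[{fmonom L}]}.
Let mon (w : seq L) : M := << FMonom w >>.

Let mon_scalerAr (c : K) (x y : M) : c *: (x * y) = x * (c *: y).
Proof.
have zE (z : M) : c *: z = c%:MP * z by rewrite mul_malgC.
have zC : c%:MP * x = x * c%:MP.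
  rewrite mul_malgC malgZ_def malgM_def fgmulgU; apply: eq_bigr => w _.
  by rewrite mulm1 mulrC.
by rewrite (zE y) (mulrA x) -zC -(mulrA _ x y); exact: zE.
Qed.

Let mon_cat w1 w2 : mon (w1 ++ w2) = mon w1 * mon w2.
Proof. by rewrite malgM_def fgmulUU mulr1 /mmul /= fmmulE. Qed.

Let mon_nil : mon [::] = 1.
Proof. by rewrite /mon -fmoneE. Qed.

Let ev (W : lmodType K) (g : seq L -> W) (x : M) : W :=
  \sum_(w <- msupp x) x@_w *: g w.

Let mon_ind (P : M -> Prop) : P 0 ->
  (forall c w x, P x -> P (c *: mon w + x)) -> forall x, P x.
Proof.
move=> P0 PD x; have -> : x = \sum_(w <- msupp x) x@_w *: mon w.
  rewrite {1}[x]monalgE; apply: eq_bigr => w _; apply/malgP => k.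
  by rewrite mcoeffZ !mcoeffU fmK mulr_natr.
elim: (enum_fset _) => [|w s IH]; first by rewrite big_nil.
by rewrite big_cons; exact: PD.
Qed.

Let evEw W g (D : {fset {fmonom L}}) (x : M) : (msupp x `<=` D)%fset ->
  @ev W g x = \sum_(w <- D) x@_w *: g w.
Proof.
move=> le; rewrite /ev [LHS](big_fset_incl _ le) // => w _ /mcoeff_outdom ->.
by rewrite scale0r.
Qed.

Let ev_linear W g (c : K) (x y : M) : @ev W g (c *: x + y) = c *: ev g x + ev g y.
Proof.
pose D := (msupp (c *: x + y) `|` (msupp x `|` msupp y))%fset.
rewrite !(@evEw _ _ D) ?fsubsetUl //; last 2 first.
- by rewrite fsubsetU // fsubsetUr orbT.
- by rewrite fsubsetU // fsubsetUl orbT.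
rewrite scaler_sumr -big_split /=; apply: eq_bigr => w _.
by rewrite mcoeffD mcoeffZ scalerDl scalerA.
Qed.

Let ev_mon W g w : @ev W g (mon w) = g w.
Proof. by rewrite (evEw _ msuppU_le) big_seq_fset1 mcoeffUU scale1r. Qed.

Lemma the_free_algebra : free_algebra K L.
Proof.
pose T := HB.pack_for (algType K) M
  (GRing.Lalgebra_isAlgebra.Build K M mon_scalerAr).
exact: (@FreeAlgebra K L T mon mon_nil mon_cat mon_ind ev ev_linear ev_mon).
Qed.

Definition freealg : algType K := freealg_ the_free_algebra.
Definition tword : seq L -> freealg := @tword_ K L _.
Definition teval : forall W : lmodType K, (seq L -> W) -> freealg -> W :=
  @teval_ K L _.

Lemma tword_nil : tword [::] = 1.
Proof. exact: tword_nil_. Qed.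
Lemma tword_cat w1 w2 : tword (w1 ++ w2) = tword w1 * tword w2.
Proof. exact: tword_cat_. Qed.
Lemma free_ind (P : freealg -> Prop) : P 0 ->
  (forall c w x, P x -> P (c *: tword w + x)) -> forall x, P x.
Proof. exact: free_ind_. Qed.

Section Eval.
Variables (W : lmodType K) (g : seq L -> W).
Fact teval_linear : linear (teval g).
Proof. by move=> c x y; exact: teval_linear_. Qed.

HB.instance Definition _ :=
  GRing.isLinear.Build K freealg W _ (teval g) teval_linear.

Lemma teval_word w : teval g (tword w) = g w.
Proof. exact: teval_word_. Qed.
End Eval.
End FreeAlgebra.

Arguments tword {K L} w.

(* The symmetric algebra of a graded space U, where [U d] is the component  *)
(* of degree d: generators are the homogeneous elements of U, subject to    *)
(* linearity in each degree and graded commutativity.                       *)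

Lemma oddzD d e : oddz (d + e) = oddz d (+) oddz e.
Proof. by rewrite /oddz; lia. Qed.

Section SymAlgebra.
Variables (K : fieldType) (U : int -> lmodType K).

Definition letter : Type := {d : int & U d}.
HB.instance Definition _ := Choice.on letter.

Definition ltr d (u : U d) : letter := Tagged U u.
Definition lpar (x : letter) : bool := oddz (tag x).
Definition wdeg (w : seq letter) : int := \sum_(x <- w) tag x.
Definition wpar (w : seq letter) : bool := oddz (wdeg w).

Local Notation T := (freealg K letter).

Inductive sym_rel : T -> Prop :=
| sym_lin d (c : K) (u v : U d) :
    sym_rel (tword [:: ltr (c *: u + v)] -
             (c *: tword [:: ltr u] + tword [:: ltr v]))
| sym_comm (x y : letter) :
    sym_rel (tword [:: x] * tword [:: y] -
             (-1) ^+ (lpar x && lpar y) *: (tword [:: y] * tword [:: x])).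

Definition symalg : Type := @algquot K T sym_rel.
HB.instance Definition _ := GRing.Lmodule.on symalg.

Definition sprod (w : seq letter) : symalg := @qpi K T sym_rel (tword w).

Definition gsym (W : lmodType K) (g : seq letter -> W) : Prop :=
  (forall p q d (c : K) (u v : U d),
     g (p ++ ltr (c *: u + v) :: q) = c *: g (p ++ ltr u :: q) + g (p ++ ltr v :: q)) /\
  (forall p q (x y : letter),
     g (p ++ x :: y :: q) = (-1) ^+ (lpar x && lpar y) *: g (p ++ y :: x :: q)).

(* When [gsym g], the linear map with value [g w] at [sprod w]. *)
Definition slift (W : lmodType K) (g : seq letter -> W) (x : symalg) : W :=
  teval g (qrepr x).

Section Lift.
Variables (W : lmodType K) (g : seq letter -> W).
Hypothesis gP : gsym g.

Let gen_ker a r b : sym_rel r -> teval g (a * r * b) = 0.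
Proof.
move=> rr; elim/free_ind: a => [|c p a IH]; first by rewrite !mul0r linear0.
rewrite !mulrDl -!scalerAl linearP /= IH addr0.
apply/eqP; rewrite scaler_eq0; apply/orP; right; apply/eqP.
elim/free_ind: b {IH} => [|e q b IH]; first by rewrite mulr0 linear0.
rewrite mulrDr -scalerAr linearP /= IH addr0.
apply/eqP; rewrite scaler_eq0; apply/orP; right; apply/eqP.
case: gP => glin gcomm; case: rr => [d f u v|x y].
  rewrite mulrBr mulrDr -scalerAr mulrBl mulrDl -scalerAl -!tword_cat.
  by rewrite linearB linearP /= !teval_word -!catA /= glin subrr.
rewrite mulrBr -scalerAr mulrBl -scalerAl -!tword_cat.
by rewrite linearB linearZ /= !teval_word -!catA /= gcomm subrr.
Qed.

Lemma slift_linear : linear (slift g).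
Proof.
move=> c; elim/qpiW=> x; elim/qpiW=> y.
by rewrite -[_ + _](linearP (@qpi K T sym_rel)) /slift !(qrepr_ker gen_ker) linearP.
Qed.

Lemma slift_sprod w : slift g (sprod w) = g w.
Proof. by rewrite /slift (qrepr_ker gen_ker) /= teval_word. Qed.
End Lift.

Lemma sprod_gsym : gsym sprod.
Proof.
have ctx p q r : sym_rel r -> @qpi K T sym_rel (tword p * r * tword q) = 0.
  move=> rr; rewrite -(linear0 (@qpi K T sym_rel)); apply: qpi_eq.
  by rewrite subr0; apply: idealM; exact: ideal_gen.
split=> [p q d c u v|p q x y]; apply/eqP; rewrite -subr_eq0; apply/eqP.
  rewrite -[RHS](ctx p q _ (sym_lin c u v)).
  rewrite mulrBr mulrDr -scalerAr mulrBl mulrDl -scalerAl -!tword_cat -!catA.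
  by rewrite linearB /= qpiD qpiZ.
rewrite -[RHS](ctx p q _ (sym_comm x y)).
rewrite mulrBr -scalerAr mulrBl -scalerAl -!tword_cat -!catA.
by rewrite linearB /= qpiZ.
Qed.

Definition sspan (P : pred (seq letter)) (x : symalg) : Prop :=
  exists2 s : seq (K * seq letter), all (P \o snd) s &
    x = \sum_(cw <- s) cw.1 *: sprod cw.2.

Lemma sspan_ind (P : pred (seq letter)) (Q : symalg -> Prop) : Q 0 ->
  (forall c w x, P w -> Q x -> Q (c *: sprod w + x)) -> forall x, sspan P x -> Q x.
Proof.
move=> Q0 QD x [s sP ->]; elim: s sP => [_|cw s IH /= /andP[wP sP]].
  by rewrite big_nil.
by rewrite big_cons; apply: QD => //; exact: IH.
Qed.

Lemma sspan0 P : sspan P 0.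
Proof. by exists [::]; rewrite ?big_nil. Qed.

Lemma sspanP P c x y : sspan P x -> sspan P y -> sspan P (c *: x + y).
Proof.
move=> [s sP ->] [r rP ->]; exists ([seq (c * cw.1, cw.2) | cw <- s] ++ r).
  by rewrite all_cat all_map rP andbT.
rewrite big_cat big_map scaler_sumr; congr (_ + _).
by apply: eq_bigr => cw _; rewrite scalerA.
Qed.

Lemma sspan_sprod (P : pred (seq letter)) w : P w -> sspan P (sprod w).
Proof. by move=> wP; exists [:: (1, w)]; rewrite /= ?wP // big_seq1 scale1r. Qed.

Lemma sspanT x : sspan predT x.
Proof.
elim/qpiW: x => x; elim/free_ind: x => [|c w x IH].
  by rewrite linear0; exact: sspan0.
by rewrite linearP; apply: sspanP => //; exact: sspan_sprod.
Qed.

Let one_ : symalg := sprod [::].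
Let mul_ : symalg -> symalg -> symalg := @algquot_mul K _ sym_rel.

Let mul1_ : left_id one_ mul_.
Proof. by rewrite /one_ /sprod tword_nil; exact: algquot_mul1. Qed.
Let mulr1_ : right_id one_ mul_.
Proof. by rewrite /one_ /sprod tword_nil; exact: algquot_mulr1. Qed.

Let sprod_cat_ w1 w2 : sprod (w1 ++ w2) = mul_ (sprod w1) (sprod w2).
Proof. by rewrite /sprod tword_cat /mul_ qpiM. Qed.

Let mulDl_ x y z : mul_ (x + y) z = mul_ x z + mul_ y z.
Proof. exact: algquot_mulDl. Qed.
Let mulDr_ x y z : mul_ x (y + z) = mul_ x y + mul_ x z.
Proof. exact: algquot_mulDr. Qed.
Let mulAl_ c x y : c *: mul_ x y = mul_ (c *: x) y.
Proof. exact: algquot_scalerAl. Qed.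
Let mulAr_ c x y : c *: mul_ x y = mul_ x (c *: y).
Proof. exact: algquot_scalerAr. Qed.

Let mul0l x : mul_ 0 x = 0.
Proof.
have := mulDl_ 0 0 x; rewrite addr0 => /eqP.
by rewrite -subr_eq subrr eq_sym => /eqP.
Qed.
Let mulr0_ x : mul_ x 0 = 0.
Proof.
have := mulDr_ x 0 0; rewrite addr0 => /eqP.
by rewrite -subr_eq subrr eq_sym => /eqP.
Qed.

Lemma wdeg_cat w1 w2 : wdeg (w1 ++ w2) = wdeg w1 + wdeg w2.
Proof. exact: big_cat. Qed.
Lemma wdeg_cons x w : wdeg (x :: w) = tag x + wdeg w.
Proof. exact: big_cons. Qed.
Lemma wpar_cat w1 w2 : wpar (w1 ++ w2) = wpar w1 (+) wpar w2.
Proof. by rewrite /wpar wdeg_cat oddzD. Qed.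
Lemma wpar_cons x w : wpar (x :: w) = lpar x (+) wpar w.
Proof. by rewrite /wpar wdeg_cons oddzD. Qed.

Lemma gsym_swap (W : lmodType K) (g : seq letter -> W) : gsym g ->
  forall p q w1 w2, g (p ++ w1 ++ w2 ++ q) =
    (-1) ^+ (wpar w1 && wpar w2) *: g (p ++ w2 ++ w1 ++ q).
Proof.
move=> [_ gC]; have one p q x w : g (p ++ x :: w ++ q) =
    (-1) ^+ (lpar x && wpar w) *: g (p ++ w ++ x :: q).
  elim: w p => [|y w IH] p /=.
    by rewrite /wpar /wdeg big_nil andbF scale1r.
  rewrite gC -[y :: x :: _]cat1s catA IH -!catA scalerA -signr_addb wpar_cons.
  by rewrite andb_addr.
move=> p q w1 w2; elim: w1 p q => [|x w1 IH] p q /=.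
  by rewrite /wpar /wdeg big_nil scale1r.
rewrite -[x :: _]cat1s catA IH -catA cat1s one scalerA -signr_addb wpar_cons.
by rewrite andb_addl addbC.
Qed.

Definition sym_homog (d : int) : symalg -> Prop := sspan [pred w | wdeg w == d].

Let proj (d : int) : symalg -> symalg :=
  slift (fun w => if wdeg w == d then sprod w else 0).

Let proj_gsym d : gsym (fun w => if wdeg w == d then sprod w else 0).
Proof.
have [lin comm] := sprod_gsym; split=> [p q e c u v|p q x y].
  rewrite !wdeg_cat !wdeg_cons; case: ifP => _; first exact: lin.
  by rewrite scaler0 addr0.
have -> : wdeg (p ++ y :: x :: q) = wdeg (p ++ x :: y :: q).
  by rewrite !wdeg_cat !wdeg_cons [tag y + _]addrCA.
case: ifP => _; first exact: comm.
by rewrite scaler0.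
Qed.

HB.instance Definition _ d := GRing.isLinear.Build K symalg symalg _ (proj d)
  (slift_linear (proj_gsym d)).

Let proj_homog d e x : sym_homog e x -> proj d x = if e == d then x else 0.
Proof.
elim/sspan_ind: x / => [|c w x /eqP we IH]; first by rewrite linear0 if_same.
rewrite linearP /= IH /proj (slift_sprod (proj_gsym d)) we.
by case: ifP; rewrite // scaler0 addr0.
Qed.

Fact sym_homog_sum x : exists (n : nat) (d : 'I_n -> int) (y : 'I_n -> symalg),
  (forall i, sym_homog (d i) (y i)) /\ x = \sum_i y i.
Proof.
have [s _ ->] := sspanT x; exists (size s).
exists (fun i => wdeg (tnth (in_tuple s) i).2).
exists (fun i => (tnth (in_tuple s) i).1 *: sprod (tnth (in_tuple s) i).2).
split=> [i|]; last exact: big_tnth.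
rewrite -[_ *: _]addr0; apply: sspanP; last exact: sspan0.
by apply: sspan_sprod; rewrite /= eqxx.
Qed.

Fact sym_homog_indep (D : seq int) (y : int -> symalg) : uniq D ->
  (forall d, sym_homog d (y d)) -> \sum_(d <- D) y d = 0 ->
  forall d, d \in D -> y d = 0.
Proof.
move=> uD yh y0 d dD; have := congr1 (proj d) y0.
rewrite linear_sum linear0 (bigD1_seq d) //= (proj_homog d (yh d)) eqxx.
rewrite big1 ?addr0 // => e ne; rewrite (proj_homog d (yh e)).
by rewrite (negPf ne).
Qed.

Fact sym_homogM d e x y :
  sym_homog d x -> sym_homog e y -> sym_homog (d + e) (mul_ x y).
Proof.
move=> hx hy; elim/sspan_ind: x / hx => [|c w x wd IH].
  by rewrite mul0l; exact: sspan0.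
rewrite mulDl_ -mulAl_; apply: sspanP => // {x IH}.
elim/sspan_ind: y / hy => [|b v y vd IH].
  by rewrite mulr0_; exact: sspan0.
rewrite mulDr_ -mulAr_; apply: sspanP => //.
rewrite -sprod_cat_; apply: sspan_sprod.
by rewrite /= wdeg_cat (eqP wd) (eqP vd).
Qed.

Fact sym_homogC d e x y : sym_homog d x -> sym_homog e y ->
  mul_ x y = (-1) ^+ (oddz d && oddz e) *: mul_ y x.
Proof.
move=> hx hy; elim/sspan_ind: x / hx => [|c w x wd IH].
  by rewrite mul0l mulr0_ scaler0.
rewrite mulDl_ mulDr_ -mulAl_ -mulAr_ IH scalerDr scalerA mulrC -scalerA.
congr (_ *: _ + _).
elim/sspan_ind: y / hy {IH} => [|b v y vd IH].
  by rewrite mulr0_ mul0l scaler0.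
rewrite mulDl_ mulDr_ -mulAl_ -mulAr_ IH scalerDr scalerA mulrC -scalerA.
congr (_ *: _ + _); rewrite -!sprod_cat_.
have := gsym_swap sprod_gsym [::] [::] w v.
by rewrite !cats0 /= /wpar (eqP wd) (eqP vd).
Qed.

HB.instance Definition _ := isGCAlgebra.Build K symalg
  (@algquot_mulA K _ sym_rel) mul1_ mulr1_
  (@algquot_mulDl K _ sym_rel) (@algquot_mulDr K _ sym_rel)
  (@algquot_scalerAl K _ sym_rel) (@algquot_scalerAr K _ sym_rel)
  (fun d => sspan0 [pred w | wdeg w == d])
  (fun d => @sspanP [pred w | wdeg w == d])
  sym_homog_sum sym_homog_indep
  (@sspan_sprod [pred w | wdeg w == 0] [::] (introT eqP (big_nil _ _ _ _)))
  sym_homogM sym_homogC.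
HB.instance Definition _ :=
  GRing.PzRing.copy symalg (GCAlgebra.sort (symalg : gcalgType K)).

Lemma sprod_nil : sprod [::] = 1. Proof. by []. Qed.
Lemma sprod_cat w1 w2 : sprod (w1 ++ w2) = sprod w1 * sprod w2.
Proof. exact: sprod_cat_. Qed.
Lemma sym_homogE d : homog d = sym_homog d. Proof. by []. Qed.
End SymAlgebra.

Section Convolution.
Variables (K : fieldType) (U : int -> lmodType K).
Local Notation letter := (letter U).

(* The terms (-1)^b u (x) v of the coproduct of x_1 ... x_n, listed as       *)
(* ((b, u), v), one for each unshuffle; this is the expansion of the product *)
(* of the x_i (x) 1 + 1 (x) x_i.                                             *)
Fixpoint coprod (w : seq letter) : seq (bool * seq letter * seq letter) :=
  if w is x :: w' then
    [seq (s.1.1, x :: s.1.2, s.2) | s <- coprod w'] ++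
    [seq (s.1.1 (+) (lpar x && wpar s.1.2), s.1.2, x :: s.2) | s <- coprod w']
  else [:: (false, [::], [::])].

Definition cosum (W : lmodType K) (b : seq letter -> seq letter -> W)
    (w : seq letter) : W :=
  \sum_(s <- coprod w) (-1) ^+ s.1.1 *: b s.1.2 s.2.

Lemma cosum_cons (W : lmodType K) (b : seq letter -> seq letter -> W) x w :
  cosum b (x :: w) = cosum (fun u v => b (x :: u) v) w +
    cosum (fun u v => (-1) ^+ (lpar x && wpar u) *: b u (x :: v)) w.
Proof.
rewrite /cosum /= big_cat !big_map; congr (_ + _).
by apply: eq_bigr => s _ /=; rewrite scalerA signr_addb.
Qed.

Lemma eq_cosum (W : lmodType K) (b b' : seq letter -> seq letter -> W) w :
  (forall u v, b u v = b' u v) -> cosum b w = cosum b' w.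
Proof. by move=> e; apply: eq_bigr => s _; rewrite e. Qed.

Lemma cosum_linear (W : lmodType K) c (b b' : seq letter -> seq letter -> W) w :
  cosum (fun u v => c *: b u v + b' u v) w = c *: cosum b w + cosum b' w.
Proof.
rewrite /cosum scaler_sumr -big_split; apply: eq_bigr => s _ /=.
by rewrite scalerDr !scalerA mulrC.
Qed.

Lemma cosumZ (W : lmodType K) c (b : seq letter -> seq letter -> W) w :
  cosum (fun u v => c *: b u v) w = c *: cosum b w.
Proof.
rewrite /cosum scaler_sumr; apply: eq_bigr => s _ /=.
by rewrite !scalerA mulrC.
Qed.

Lemma gsym_cons (W : lmodType K) (g : seq letter -> W) x :
  gsym g -> gsym (fun w => g (x :: w)).
Proof. by case=> lin comm; split=> p; [exact: (lin (x :: p)) | exact: (comm (x :: p))]. Qed.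

Lemma gsym_sign (W : lmodType K) (g : seq letter -> W) (b : bool) :
  gsym g -> gsym (fun w => (-1) ^+ (b && wpar w) *: g w).
Proof.
case=> lin comm; split=> [p q d c u v|p q x y].
  rewrite !wpar_cat !wpar_cons lin scalerDr !scalerA; congr (_ *: _ + _).
  by rewrite mulrC.
rewrite comm !wpar_cat !wpar_cons (addbCA (lpar y)) !scalerA.
by rewrite mulrC.
Qed.

Lemma gsym_linear (W V : lmodType K) (f : {linear W -> V}) (g : seq letter -> W) :
  gsym g -> gsym (f \o g).
Proof.
by case=> lin comm; split=> p q *; rewrite /= ?lin ?linearP // comm linearZ.
Qed.

Lemma cosum_gsym (W : lmodType K) (b : seq letter -> seq letter -> W) :
  (forall v, gsym (b ^~ v)) -> (forall u, gsym (b u)) -> gsym (cosum b).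
Proof.
have left_l (b' : seq letter -> seq letter -> W) z : (forall v, gsym (b' ^~ v)) ->
    forall v, gsym (fun u => b' (z :: u) v).
  by move=> bl v; exact: (gsym_cons z (bl v)).
have right_l (b' : seq letter -> seq letter -> W) z : (forall v, gsym (b' ^~ v)) ->
    forall v, gsym (fun u => (-1) ^+ (lpar z && wpar u) *: b' u (z :: v)).
  by move=> bl v; exact: (gsym_sign _ (bl (z :: v))).
have right_r (b' : seq letter -> seq letter -> W) z : (forall u, gsym (b' u)) ->
    forall u, gsym (fun v => (-1) ^+ (lpar z && wpar u) *: b' u (z :: v)).
  move=> br u; have [lin comm] := gsym_cons z (br u).
  split=> [p q d c u1 u2|p q x y]; first by rewrite lin scalerDr !scalerA mulrC.
  by rewrite comm !scalerA mulrC.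
move=> bl br; split=> [p q d c u v|p q x y].
  elim: p b bl br => [|z p IH] b bl br.
    rewrite !cat0s !cosum_cons scalerDr addrACA -!cosum_linear.
    congr (_ + _); apply: eq_cosum => w1 w2.
      exact: (proj1 (bl w2) [::]).
    have /= -> := proj1 (br w1) [::] w2 d c u v.
    by rewrite scalerDr !scalerA mulrC.
  rewrite !cat_cons !cosum_cons scalerDr addrACA.
  rewrite (IH (fun u v => b (z :: u) v) (left_l b z bl) (fun u => br (z :: u))).
  by rewrite (IH (fun u v => _ *: b u (z :: v)) (right_l b z bl) (right_r b z br)).
elim: p b bl br => [|z p IH] b bl br; last first.
  rewrite !cat_cons !cosum_cons scalerDr.
  rewrite (IH (fun u v => b (z :: u) v) (left_l b z bl) (fun u => br (z :: u))).
  by rewrite (IH (fun u v => _ *: b u (z :: v)) (right_l b z bl) (right_r b z br)).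
rewrite !cat0s !cosum_cons !scalerDr [RHS]addrACA.
congr (_ + _ + (_ + _)); rewrite -cosumZ; apply: eq_cosum => w1 w2.
- exact: (proj2 (bl w2) [::]).
- rewrite scalerA -signr_addb wpar_cons.
  by case: (lpar x); case: (lpar y); case: (wpar w1).
- rewrite scalerA -signr_addb wpar_cons.
  by case: (lpar x); case: (lpar y); case: (wpar w1).
- have /= -> := proj2 (br w1) [::] w2 x y; rewrite !scalerA -!signr_addb.
  by case: (lpar x); case: (lpar y); case: (wpar w1).
Qed.

Variable B : gcalgType K.
Implicit Types (F G : symalg U -> pser B).

(* F * G, for F and G of degree zero: there is no sign in                   *)
(* (F (x) G) (x (x) y) = F x (x) G y.                                       *)
Definition conv F G : symalg U -> pser B :=
  slift (cosum (fun u v => F (sprod u) * G (sprod v))).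

Definition conv_unit : symalg U -> pser B :=
  slift (W := pser B) (fun w => if w is [::] then 1 else 0).

Fixpoint conv_exp F (m : nat) : symalg U -> pser B :=
  if m is m'.+1 then conv F (conv_exp F m') else conv_unit.

(* On a product of n elements of U the sum over m stops at m = n, because   *)
(* F^{*m} vanishes there for m > n when F 1 = 0; see [exp_starE].           *)
Definition exp_star F : symalg U -> pser B :=
  slift (fun w => \sum_(m < (size w).+1) (m`!%:R)^-1 *: conv_exp F m (sprod w)).

Lemma pserM_scalerAl c (x y : pser B) : c *: (x * y) = (c *: x) * y.
Proof.
apply/funext => n; rewrite pserZ !pserM scaler_sumr.
by apply: eq_bigr => i _; rewrite gcZAl.
Qed.
Lemma pserM_scalerAr c (x y : pser B) : c *: (x * y) = x * (c *: y).
Proof.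
apply/funext => n; rewrite pserZ !pserM scaler_sumr.
by apply: eq_bigr => i _; rewrite gcZAr.
Qed.

Lemma conv_unit_gsym :
  gsym (U := U) (W := pser B) (fun w => if w is [::] then 1 else 0).
Proof. by split=> [[|? ?]|[|? ?]] *; rewrite /= ?scaler0 ?addr0. Qed.

Lemma conv_gsym F G : linear F -> linear G ->
  gsym (cosum (fun u v => F (sprod u) * G (sprod v))).
Proof.
move=> Flin Glin; have [lin comm] := sprod_gsym U.
have FZ c x : F (c *: x) = c *: F x by exact: (GRing.scalable_linear Flin).
have GZ c x : G (c *: x) = c *: G x by exact: (GRing.scalable_linear Glin).
apply: cosum_gsym => z; split=> [p q d c u v|p q x y].
- by rewrite lin Flin mulrDl -pserM_scalerAl.
- by rewrite comm FZ -pserM_scalerAl.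
- by rewrite lin Glin mulrDr -pserM_scalerAr.
- by rewrite comm GZ -pserM_scalerAr.
Qed.

Lemma conv_unit_linear : linear conv_unit.
Proof. exact: (slift_linear conv_unit_gsym). Qed.

Lemma conv_linear F G : linear F -> linear G -> linear (conv F G).
Proof. by move=> Flin Glin; exact: (slift_linear (conv_gsym Flin Glin)). Qed.

Lemma conv_unitE w : conv_unit (sprod w) = if w is [::] then 1 else 0.
Proof. exact: (slift_sprod conv_unit_gsym). Qed.

Lemma convE F G w : linear F -> linear G -> conv F G (sprod w) =
  \sum_(s <- coprod w) (-1) ^+ s.1.1 *: (F (sprod s.1.2) * G (sprod s.2)).
Proof. by move=> Flin Glin; exact: (slift_sprod (conv_gsym Flin Glin)). Qed.

Lemma conv_exp_linear F m : linear F -> linear (conv_exp F m).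
Proof.
by move=> Flin; elim: m => [|m IH]; [exact: conv_unit_linear | exact: conv_linear].
Qed.

Lemma coprod_size w s : s \in coprod w -> size w = (size s.1.2 + size s.2)%N.
Proof.
elim: w s => [|x w IH] s /=; first by rewrite inE => /eqP ->.
by rewrite mem_cat => /orP[] /mapP[r /IH -> ->] /=; rewrite ?addnS.
Qed.

Lemma conv_exp_vanish F m w : linear F -> F 1 = 0 -> (size w < m)%N ->
  conv_exp F m (sprod w) = 0.
Proof.
move=> Flin F1; elim: m w => // m IH w ltwm.
rewrite [LHS](convE _ Flin (conv_exp_linear m Flin)) big_seq big1 // => s sw.
case E: s.1.2 => [|x u]; first by rewrite F1 mul0r scaler0.
rewrite IH ?mulr0 ?scaler0 //; move: ltwm; rewrite (coprod_size sw) E /=.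
by rewrite addSn ltnS; apply: leq_ltn_trans; exact: leq_addl.
Qed.

Lemma exp_star_gsym F : linear F ->
  gsym (fun w => \sum_(m < (size w).+1) (m`!%:R)^-1 *: conv_exp F m (sprod w)).
Proof.
move=> Flin; have [lin comm] := sprod_gsym U; split=> [p q d c u v|p q x y].
  rewrite !size_cat /= scaler_sumr -big_split; apply: eq_bigr => m _ /=.
  by rewrite lin (conv_exp_linear m Flin) scalerDr !scalerA mulrC.
rewrite !size_cat /= scaler_sumr; apply: eq_bigr => m _.
rewrite comm (GRing.scalable_linear (conv_exp_linear m Flin)).
by rewrite !scalerA mulrC.
Qed.

Lemma exp_star_linear F : linear F -> linear (exp_star F).
Proof. by move=> Flin; exact: (slift_linear (exp_star_gsym Flin)). Qed.

(* exp_star F = sum_m 1/m! F^{*m}, a pointwise finite sum.                  *)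
Lemma exp_starE F : linear F -> F 1 = 0 -> forall x, exists N, forall M,
  (N <= M)%N -> exp_star F x = \sum_(m < M) (m`!%:R)^-1 *: conv_exp F m x.
Proof.
move=> Flin F1 x; elim/sspan_ind: x / (sspanT x) => [|c w x _ [N IH]].
  have lin0 (G : symalg U -> pser B) : linear G -> G 0 = 0.
    by move=> /GRing.zmod_morphism_linear /(_ 0 0); rewrite !subrr.
  exists 0%N => M _; rewrite (lin0 _ (exp_star_linear Flin)) big1 // => m _.
  by rewrite (lin0 _ (conv_exp_linear m Flin)) scaler0.
exists (maxn N (size w).+1) => M; rewrite geq_max => /andP[leNM ltwM].
rewrite (exp_star_linear Flin) (IH M leNM) [exp_star F _](slift_sprod (exp_star_gsym Flin)).
rewrite (big_ord_widen _ (fun m => (m`!%:R)^-1 *: conv_exp F m (sprod w)) ltwM).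
rewrite big_mkcond scaler_sumr -big_split; apply: eq_bigr => m _ /=.
rewrite (conv_exp_linear m Flin) scalerDr; congr (_ + _).
case: ltnP => [_|lt]; first by rewrite !scalerA mulrC.
by rewrite (conv_exp_vanish Flin F1 lt) !scaler0.
Qed.
End Convolution.

Definition hom0 (K : fieldType) (k : int) (A B : gcalgType K)
    (phi : A -> pser B) : Prop :=
  linear phi /\ forall d x, homog d x -> pser_homog k d (phi x).

Definition CL_morphism (K : fieldType) (k : int) (U : int -> lmodType K)
    (B : gcalgType K) (D : derivedBV k (symalg U)) (D' : derivedBV k B)
    (phi : symalg U -> pser B) : Prop :=
  [/\ hom0 k phi,
      phi 1 = 0,
      (forall x, text (exp_star phi) (D x) = D' (text (exp_star phi) x)) &
      (forall n x, sspan [pred w | (n + 2 <= size w)%N] x -> phi x n = 0)].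

(* Main.v *)
From HB Require Import structures.
Require Import Defs.
From mathcomp Require Import all_boot all_order all_algebra.
From mathcomp Require Import boolp zify.

Set Implicit Arguments.
Unset Strict Implicit.
Unset Printing Implicit Defensive.

Import GRing.Theory.
Local Open Scope ring_scope.

(** The statement compares two notions of smallness modulo powers of t: the
    values of phi on products of i elements of U, and the cumulants of
    exp_star phi on arbitrary elements of S(U).  Both sides share the
    compatibility with the BV operators, so everything rests on relating phi
    to the cumulants of exp_star phi.

    Fix homogeneous elements indexed by 0, ..., N-1.  A function that attaches
    to each subset X of the indices a series whose degree is the total degree
    of X can be read as an element of B[[t]] tensored with square-zero symbols
    that absorb the Koszul signs.  Such functions form a commutative ring
    ([setfun]), on which restriction to the subsets that contain a given index
    x is a derivation ([rho x], [rhoM]).  Exponentials are then described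
    without denominators: c is the logarithm of G when
    rho x G = rho x c * G for all x ([is_log], unique by [log_uniq]).

    In this ring convolution becomes the product ([hat_conv]), so on the
    letters of a word the function X |-> phi(X) is the logarithm of
    X |-> exp_star phi (X) ([exp_star_log]); and Moebius inversion over set
    partitions says that the cumulants of f are the logarithm of
    X |-> f(prod_(i in X) a_i) ([mobius_log], [cumulant_log]).  Hence the
    cumulant of n letters is the value of phi on their product
    ([cumulant_letters]), which proves that a BV morphism satisfies the
    vanishing condition of Cieliebak and Latschev.

    For the converse, multilinearity reduces to cumulants of n words
    ([multilinear_words]).  Grouping the letters of the words amounts to
    discarding the values of exp_star phi on sets of letters that cut a word.
    This is done by gluing two letters at a time: if c is the logarithm before
    a and b are glued, then afterwards it is c on the sets that avoid a and b,
    plus rho a (rho b c) + rho a c * rho b c ([merge_logP]).  The last two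
    terms lose at most one power of t, while the number of free letters drops
    by one, so the bound t^(size - 1) for phi becomes the bound t^(n - 1) for
    the cumulant ([cumulant_words]).  Words of length zero are handled apart:
    a cumulant of at least two elements, one of which is the unit, vanishes
    ([cumulant_unit]). *)

(** * Degrees of power series *)

Section PserHomog.
Variables (K : fieldType) (k : int) (A : gcalgType K).
Implicit Types (x y : pser A) (d e : int).

Lemma pser_homog0 d : pser_homog k d (0 : pser A).
Proof. by move=> n; exact: homog0. Qed.

Lemma pser_homogP d (c : K) x y :
  pser_homog k d x -> pser_homog k d y -> pser_homog k d (c *: x + y).
Proof. by move=> hx hy n; rewrite pserD pserZ; exact: homogP. Qed.

Lemma pser_homogZ d (c : K) x : pser_homog k d x -> pser_homog k d (c *: x).
Proof.
by move=> hx; have := pser_homogP c hx (pser_homog0 d); rewrite addr0.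
Qed.

Lemma pser_homogD d x y :
  pser_homog k d x -> pser_homog k d y -> pser_homog k d (x + y).
Proof. by move=> hx hy; have := pser_homogP 1 hx hy; rewrite scale1r. Qed.

Lemma homog_sumr (I : Type) (r : seq I) (P : pred I) (F : I -> A) d :
  (forall i, P i -> homog d (F i)) -> homog d (\sum_(i <- r | P i) F i).
Proof.
move=> h; apply: (big_ind (homog d)) => // [|x y hx hy]; first exact: homog0.
by have := homogP _ 1 _ _ hx hy; rewrite scale1r.
Qed.

Lemma pser_homog_sum (I : Type) (r : seq I) (P : pred I) (F : I -> pser A) d :
  (forall i, P i -> pser_homog k d (F i)) ->
  pser_homog k d (\sum_(i <- r | P i) F i).
Proof.
move=> h; apply: (big_ind (pser_homog k d)) => //; first exact: pser_homog0.
exact: pser_homogD.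
Qed.

Lemma pser_homogM d e x y :
  pser_homog k d x -> pser_homog k e y -> pser_homog k (d + e) (x * y).
Proof.
move=> hx hy n; rewrite pserM; apply: homog_sumr => i _.
have -> : d + e + n%:Z * (k - 1) =
    (d + i%:Z * (k - 1)) + (e + (n - i)%N%:Z * (k - 1)).
  rewrite addrACA -mulrDl -PoszD subnKC //; by case: i.
exact: homogM.
Qed.

Lemma pser_homog1 : pser_homog k 0 (1 : pser A).
Proof.
by case=> [|n]; [rewrite mul0r addr0; exact: homog1 | exact: homog0].
Qed.

Lemma oddz_pser (kodd : odd `|k|%N) d n : oddz (d + n%:Z * (k - 1)) = oddz d.
Proof. by rewrite /oddz; nia. Qed.

(** As k is odd, t has even degree 1 - k, so all the coefficients of a
    homogeneous series have the same parity and t causes no sign. *)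
Lemma pser_homogC (kodd : odd `|k|%N) d e x y :
  pser_homog k d x -> pser_homog k e y ->
  x * y = (-1) ^+ (oddz d && oddz e) *: (y * x).
Proof.
move=> hx hy; apply/funext => n; rewrite pserZ !pserM scaler_sumr.
rewrite (reindex_inj rev_ord_inj) /=; apply: eq_bigr => i _.
rewrite subSS subKn -1?ltnS //.
have := homog_comm _ _ _ _ (hx (n - i)%N) (hy i).
by rewrite !oddz_pser.
Qed.
End PserHomog.

Lemma signr_scale (K : fieldType) (A : gcalgType K) (n : nat) (x : pser A) :
  (-1) ^+ n * x = (-1) ^+ n *: x.
Proof.
by rewrite -signr_odd -[in RHS]signr_odd; case: (odd n);
   rewrite ?expr1 ?mulN1r ?scaleN1r // !expr0 mul1r scale1r.
Qed.

(** * Signs of unshuffles *)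
Section Sign.
Variables (N : nat) (e : 'I_N -> int).
Implicit Types (X Y Z : {set 'I_N}).

Definition wt X : int := \sum_(x in X) e x.

Definition inversion_par (y z : 'I_N) : bool :=
  [&& (z < y)%N, oddz (e y) & oddz (e z)].

(** The Koszul sign of the rearrangement of Y :|: Z, in increasing order, into
    Y followed by Z.  The exclusive or makes it biadditive in Y and Z, from
    which the cocycle identity behind associativity follows. *)
Definition shuffle_par Y Z : bool :=
  \big[addb/false]_(y in Y) \big[addb/false]_(z in Z) inversion_par y z.

Lemma wtU Y Z : [disjoint Y & Z] -> wt (Y :|: Z) = wt Y + wt Z.
Proof.
by move=> dYZ; rewrite /wt (eq_bigl _ _ (fun x => in_setU x Y Z)) bigU.
Qed.

Lemma wt0 : wt set0 = 0. Proof. exact: big_set0. Qed.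

Lemma oddz_wt Y : oddz (wt Y) = \big[addb/false]_(y in Y) oddz (e y).
Proof. exact: (big_morph oddz oddzD). Qed.

Lemma shuffle_parUl X Y Z : [disjoint X & Y] ->
  shuffle_par (X :|: Y) Z = shuffle_par X Z (+) shuffle_par Y Z.
Proof.
by move=> dXY; rewrite /shuffle_par (eq_bigl _ _ (fun x => in_setU x X Y)) bigU.
Qed.

Lemma shuffle_parUr X Y Z : [disjoint Y & Z] ->
  shuffle_par X (Y :|: Z) = shuffle_par X Y (+) shuffle_par X Z.
Proof.
move=> dYZ; rewrite /shuffle_par -big_split; apply: eq_bigr => x _ /=.
by rewrite (eq_bigl _ _ (fun x => in_setU x Y Z)) bigU.
Qed.

Lemma shuffle_par0l Z : shuffle_par set0 Z = false. Proof. exact: big_set0. Qed.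
Lemma shuffle_par0r Y : shuffle_par Y set0 = false.
Proof. by rewrite /shuffle_par big1 // => y _; exact: big_set0. Qed.

Lemma shuffle_par_swap Y Z : [disjoint Y & Z] ->
  shuffle_par Y Z (+) shuffle_par Z Y = oddz (wt Y) && oddz (wt Z).
Proof.
move=> dYZ; rewrite /shuffle_par [in X in _ (+) X]exchange_big -big_split /=.
rewrite !oddz_wt big_distrl; apply: eq_bigr => y yY /=.
rewrite big_distrr -big_split; apply: eq_bigr => z zZ /=.
have: y != z by apply: contraL zZ => /eqP <-; rewrite (disjointFr dYZ).
rewrite /inversion_par neq_ltn.
by case: ltngtP => //= _ _; case: (oddz _); case: (oddz _).
Qed.
End Sign.

Lemma setD_part (N : nat) (X Y Z : {set 'I_N}) :
  [disjoint Y & Z] -> Y :|: Z = X -> X :\: Y = Z.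
Proof.
move=> dYZ <-; rewrite setDUl setDv set0U.
by apply/setDidPl; rewrite disjoint_sym.
Qed.

Lemma disjointDr (T : finType) (A B : {set T}) : [disjoint A & B :\: A].
Proof.
by rewrite disjoint_sym disjoints_subset; apply/subsetP=> x;
  rewrite !inE => /andP[].
Qed.

(** * The commutative ring of set functions *)

(** The degree-zero part of the tensor product of B[[t]] with the graded
    commutative algebra on square-zero symbols of degrees - e i, i < N: the
    value at X is the coefficient of the product of the symbols of X.  The
    proof [kodd] is a parameter of the type because the ring structure declared
    on it is commutative only for odd k. *)
Record setfun (K : fieldType) (k : int) (kodd : odd `|k|%N) (B : gcalgType K)
    (N : nat) (e : 'I_N -> int) := SetFun {
  sfval :> {set 'I_N} -> pser B;
  sfval_homog : forall X, pser_homog k (wt e X) (sfval X) }.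

HB.instance Definition _ K k kodd B N e := gen_eqMixin (@setfun K k kodd B N e).
HB.instance Definition _ K k kodd B N e :=
  gen_choiceMixin (@setfun K k kodd B N e).

Section SetFunRing.
Variables (K : fieldType) (k : int) (kodd : odd `|k|%N) (B : gcalgType K).
Variables (N : nat) (e : 'I_N -> int).
Local Notation E := (setfun kodd B e).
Implicit Types (g h l : E) (X Y Z T : {set 'I_N}).

Lemma setfunP g h : (forall X, g X = h X) -> g = h.
Proof.
case: g h => [g gP] [h hP] /= gh; have E : g = h by apply/funext.
by case: _ / E hP => hP; congr SetFun; exact: Prop_irrelevance.
Qed.

Definition setfun_zero : E := SetFun kodd (fun X => pser_homog0 k B (wt e X)).

Fact setfun_add_subproof g h X : pser_homog k (wt e X) (g X + h X).
Proof. by apply: pser_homogD; exact: sfval_homog. Qed.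
Definition setfun_add g h : E := SetFun kodd (setfun_add_subproof g h).

Fact setfun_opp_subproof g X : pser_homog k (wt e X) (- g X).
Proof. by rewrite -scaleN1r; apply: pser_homogZ; exact: sfval_homog. Qed.
Definition setfun_opp g : E := SetFun kodd (setfun_opp_subproof g).

Fact setfun_one_subproof X : pser_homog k (wt e X)
  (if X == set0 then 1 : pser B else 0).
Proof.
case: eqP => [->|_]; last exact: pser_homog0.
by rewrite wt0; exact: pser_homog1.
Qed.
Definition setfun_one : E := SetFun kodd setfun_one_subproof.

Definition setfun_prod (g h : {set 'I_N} -> pser B) X : pser B :=
  \sum_(Y : {set 'I_N} | Y \subset X) (-1) ^+ shuffle_par e Y (X :\: Y) *:
    (g Y * h (X :\: Y)).

Fact setfun_mul_subproof g h X : pser_homog k (wt e X) (setfun_prod g h X).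
Proof.
apply: pser_homog_sum => Y sYX; apply: pser_homogZ.
rewrite -[X in wt e X](setID X Y) (setIidPr sYX) wtU ?disjointDr //.
by apply: pser_homogM; exact: sfval_homog.
Qed.
Definition setfun_mul g h : E := SetFun kodd (setfun_mul_subproof g h).

Fact setfun_addA : associative setfun_add.
Proof. by move=> g h l; apply: setfunP => X /=; exact: addrA. Qed.
Fact setfun_addC : commutative setfun_add.
Proof. by move=> g h; apply: setfunP => X /=; exact: addrC. Qed.
Fact setfun_add0 : left_id setfun_zero setfun_add.
Proof. by move=> g; apply: setfunP => X /=; exact: add0r. Qed.
Fact setfun_addN : left_inverse setfun_zero setfun_opp setfun_add.
Proof. by move=> g; apply: setfunP => X /=; exact: addNr. Qed.

(* Both sides are the sum over the ordered splittings of X in three parts. *)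
Fact setfun_mulA : associative setfun_mul.
Proof.
move=> g h l; apply: setfunP => X /=; rewrite /setfun_prod.
pose t Y Z W : pser B :=
  (-1) ^+ (shuffle_par e Y Z (+) shuffle_par e Y W (+) shuffle_par e Z W) *:
  (g Y * (h Z * l W)).
transitivity (\sum_(Y : {set 'I_N} | Y \subset X)
    \sum_(Z : {set 'I_N} | Z \subset X :\: Y) t Y Z (X :\: Y :\: Z)).
  apply: eq_bigr => Y sYX; rewrite mulr_sumr scaler_sumr;
    apply: eq_bigr => Z sZ.
  rewrite -pserM_scalerAr scalerA -signr_addb;
    congr ((-1) ^+ nat_of_bool _ *: _).
  have -> : shuffle_par e Y (X :\: Y) = shuffle_par e Y Z (+) shuffle_par e Y
    (X :\: Y :\: Z).
    by rewrite -shuffle_parUr ?disjointDr // -{1}(setIidPr sZ) setID.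
  by [].
transitivity (\sum_(T : {set 'I_N} | T \subset X)
    \sum_(Y : {set 'I_N} | Y \subset T) t Y (T :\: Y) (X :\: T)); last first.
  apply: eq_bigr => T sTX; rewrite mulr_suml scaler_sumr;
    apply: eq_bigr => Y sY.
  rewrite -pserM_scalerAl -mulrA scalerA -signr_addb;
    congr ((-1) ^+ nat_of_bool _ *: _).
  have -> : shuffle_par e T (X :\: T) = shuffle_par e Y (X :\: T) (+)
    shuffle_par e (T :\: Y) (X :\: T).
    by rewrite -shuffle_parUl ?disjointDr // -{1}(setIidPr sY) setID.
  by rewrite -addbA addbC.
rewrite [RHS](exchange_big_dep (fun Y => Y \subset X)) /=; last first.
  by move=> T Y sTX sYT; apply: subset_trans sTX.
apply: eq_bigr => Y sYX.
rewrite [RHS](reindex_onto (fun Z => Y :|: Z) (fun T => T :\: Y)) /=;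
  last first.
  by move=> T /andP[_ sYT]; rewrite -[RHS](setID T Y) (setIidPr sYT).
have eqZ Z : [&& Y :|: Z \subset X, Y \subset Y :|: Z & (Y :|: Z) :\: Y == Z] =
    (Z \subset X :\: Y).
  rewrite subUset sYX subsetUl /= subsetD setDUl setDv set0U.
  by rewrite (sameP eqP setDidPl).
apply: eq_big => [Z|Z]; first by rewrite -eqZ andbA.
rewrite -eqZ => /and3P[_ _ /eqP YZ]; rewrite YZ; congr t.
by rewrite setDDl.
Qed.

Fact setfun_mulC : commutative setfun_mul.
Proof.
move=> g h; apply: setfunP => X /=; rewrite /setfun_prod.
rewrite [RHS](reindex_onto (fun Y => X :\: Y) (fun Y => X :\: Y)) /=;
  last first.
  by move=> Y sYX; rewrite setDDr setDv set0U; apply/setIidPr.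
apply: eq_big => [Y|Y sYX].
  rewrite subsetDl setDDr setDv set0U.
  by apply/idP/eqP => /setIidPr.
rewrite setDDr setDv set0U (setIidPr sYX).
rewrite (pser_homogC kodd (sfval_homog g Y) (sfval_homog h _)) scalerA
  -signr_addb.
by rewrite -shuffle_par_swap ?disjointDr // addKb.
Qed.

Fact setfun_mul1 : left_id setfun_one setfun_mul.
Proof.
move=> g; apply: setfunP => X /=;
  rewrite /setfun_prod (bigD1 set0) ?sub0set //=.
rewrite eqxx setD0 shuffle_par0l scale1r mul1r big1 ?addr0 // => Y
  /andP[_ /negPf ->].
by rewrite mul0r scaler0.
Qed.

Fact setfun_mulDl : left_distributive setfun_mul setfun_add.
Proof.
move=> g h l; apply: setfunP => X /=; rewrite /setfun_prod -big_split /=.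
by apply: eq_bigr => Y _; rewrite mulrDl scalerDr.
Qed.

HB.instance Definition _ :=
  GRing.isZmodule.Build E setfun_addA setfun_addC setfun_add0 setfun_addN.
HB.instance Definition _ :=
  GRing.Zmodule_isComPzRing.Build E setfun_mulA setfun_mulC setfun_mul1
    setfun_mulDl.

Lemma setfun0 X : (0 : E) X = 0. Proof. by []. Qed.
Lemma setfunD g h X : (g + h) X = g X + h X. Proof. by []. Qed.
Lemma setfunN g X : (- g) X = - g X. Proof. by []. Qed.
Lemma setfun1 X : (1 : E) X = if X == set0 then 1 else 0. Proof. by []. Qed.
Lemma setfunM g h X : (g * h) X =
  \sum_(Y : {set 'I_N} | Y \subset X) (-1) ^+ shuffle_par e Y (X :\: Y) *:
    (g Y * h (X :\: Y)).
Proof. by []. Qed.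
Lemma setfun_sum (I : Type) (r : seq I) (P : pred I) (F : I -> E) X :
  (\sum_(i <- r | P i) F i) X = \sum_(i <- r | P i) F i X.
Proof. by elim/big_rec2: _ => [|i _ y _ <-]. Qed.
Lemma setfunMn g n X : (g *+ n) X = g X *+ n.
Proof. by elim: n => // n IH; rewrite !mulrS setfunD IH. Qed.
Lemma setfun_sign g n X : ((-1) ^+ n * g) X = (-1) ^+ n *: g X.
Proof.
rewrite -signr_odd -[in RHS]signr_odd; case: (odd n).
  by rewrite expr1 mulN1r scaleN1r.
by rewrite mul1r scale1r.
Qed.

Lemma setfunM_set0 g h : (g * h) set0 = g set0 * h set0.
Proof.
rewrite setfunM (bigD1 set0) ?sub0set //= setD0 shuffle_par0l scale1r.
by rewrite big1 ?addr0 // => Y; rewrite subset0 => /andP[->].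
Qed.

(** A product only sees the values of its factors on disjoint sets. *)
Lemma setfun_mul_eq g h g' h' :
  (forall Y Z, [disjoint Y & Z] -> g Y * h Z = g' Y * h' Z) -> g * h = g' * h'.
Proof.
move=> gh; apply: setfunP => X; rewrite !setfunM; apply: eq_bigr => Y _.
by rewrite gh ?disjointDr.
Qed.

Fact restr_subproof (Q : pred {set 'I_N}) g X :
  pser_homog k (wt e X) (if Q X then g X else 0).
Proof. by case: ifP => _; [exact: sfval_homog | exact: pser_homog0]. Qed.
Definition restr Q g : E := SetFun kodd (restr_subproof Q g).

Lemma restrE Q g X : restr Q g X = if Q X then g X else 0. Proof. by []. Qed.

Fact restr_is_additive Q : zmod_morphism (restr Q).
Proof.
move=> g h; apply: setfunP => X; rewrite setfunD setfunN !restrE.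
by case: ifP; rewrite ?subr0.
Qed.
HB.instance Definition _ Q :=
  GRing.isZmodMorphism.Build E E (restr Q) (restr_is_additive Q).

Lemma restrC Q Q' g : restr Q (restr Q' g) = restr Q' (restr Q g).
Proof. by apply: setfunP => X; rewrite !restrE; do 2!case: ifP. Qed.

(** The operator x d/dx, for x the square-zero symbol of that index. *)
Definition rho (x : 'I_N) : E -> E := restr (fun X => x \in X).
HB.instance Definition _ x := GRing.Additive.on (rho x).

Lemma rhoE x g X : rho x g X = if x \in X then g X else 0. Proof. by []. Qed.

(** In a splitting of X in two parts, x belongs to exactly one of them. *)
Lemma rhoM x g h : rho x (g * h) = rho x g * h + g * rho x h.
Proof.
apply: setfunP => X; rewrite setfunD rhoE !setfunM -big_split /=;
  case: ifP => xX.
  apply: eq_bigr => Y sYX; rewrite inE xX andbT.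
  by case: (x \in Y); rewrite /= ?mul0r ?mulr0 ?scaler0 ?addr0 ?add0r.
rewrite big1 // => Y /subsetP sYX; rewrite inE xX andbF mulr0 scaler0 addr0.
case: ifP => [/sYX|_]; first by rewrite xX.
by rewrite mul0r scaler0.
Qed.

Lemma rho1 x : rho x (1 : E) = 0.
Proof.
apply: setfunP => X; rewrite rhoE setfun1; case: ifP => // xX;
  case: eqP => // X0.
by rewrite X0 inE in xX.
Qed.

Lemma rho_sign x m : rho x ((-1) ^+ m : E) = 0.
Proof.
rewrite -signr_odd; case: (odd m); last exact: rho1.
by rewrite expr1 raddfN /= rho1 oppr0.
Qed.

Lemma rhoX x g m : rho x (g ^+ m.+1) = rho x g * g ^+ m *+ m.+1.
Proof.
elim: m => [|m IH]; first by rewrite expr1 expr0 mulr1.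
rewrite exprS rhoM IH mulrnAr [in RHS]mulrS; congr (_ + _ *+ _).
by rewrite mulrCA -exprS.
Qed.
End SetFunRing.

(** * Divisibility by powers of t *)
Section OrderOfVanishing.
Variables (K : fieldType) (A : gcalgType K).
Implicit Types (x y : pser A) (m n : nat).

Lemma tmod0W m n x : (m <= n)%N -> tmod0 n x -> tmod0 m x.
Proof. by move=> mn h i im; apply: h; apply: leq_trans im mn. Qed.

Lemma tmod0D m x y : tmod0 m x -> tmod0 m y -> tmod0 m (x + y).
Proof. by move=> hx hy i im; rewrite pserD hx ?hy ?addr0. Qed.

Lemma tmod0Z m (c : K) x : tmod0 m x -> tmod0 m (c *: x).
Proof. by move=> hx i im; rewrite pserZ hx ?scaler0. Qed.

Lemma tmod0M m n x y : tmod0 m x -> tmod0 n y -> tmod0 (m + n) (x * y).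
Proof.
move=> hx hy i im; rewrite pserM big1 // => j _.
have [jm|mj] := ltnP j m; first by rewrite hx ?mul0r.
by rewrite hy ?mulr0 //; have := ltn_ord j; lia.
Qed.

Lemma tmod0_sum m (I : Type) (r : seq I) (P : pred I) (F : I -> pser A) :
  (forall i, P i -> tmod0 m (F i)) -> tmod0 m (\sum_(i <- r | P i) F i).
Proof. by move=> h; apply: (big_ind (tmod0 m)) => //; exact: tmod0D. Qed.
End OrderOfVanishing.

(** * Logarithms of set functions *)
Section SetFunLog.
Variables (K : fieldType) (k : int) (kodd : odd `|k|%N) (B : gcalgType K).
Variables (N : nat) (e : 'I_N -> int).
Local Notation E := (setfun kodd B e).
Implicit Types (g h G c r : E) (X Y Z : {set 'I_N}) (x a b : 'I_N).

(** The differential equation of G = exp c.  It determines c from G and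
    involves no factorials. *)
Definition is_log G c : Prop :=
  [/\ G set0 = 1, c set0 = 0 & forall x, rho x G = rho x c * G].

(** G is 1 plus a nilpotent element; the induction on the size of X inverts
    it. *)
Lemma mul_unipotent_eq0 h G : G set0 = 1 -> h * G = 0 -> h = 0.
Proof.
move=> G0 hG; apply: setfunP => X; have [m] := ubnP #|X|.
elim: m X => // m IH X; rewrite ltnS => Xm.
have := congr1 (fun g : E => g X) hG; rewrite setfunM (bigD1 X) //= setDv.
rewrite shuffle_par0r scale1r G0 mulr1 big1 ?addr0 // => Y /andP[sYX nYX].
rewrite IH ?mul0r ?scaler0 // (leq_trans _ Xm) // proper_card //.
by rewrite properEneq nYX.
Qed.

Lemma log_rho_uniq G c h x : is_log G c -> rho x G = h * G -> rho x c = h.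
Proof.
move=> [G0 _ cG] hG; apply/eqP; rewrite -subr_eq0; apply/eqP.
by apply: (mul_unipotent_eq0 G0); rewrite mulrBl -cG -hG subrr.
Qed.

Lemma log_uniq G c c' : is_log G c -> is_log G c' -> c = c'.
Proof.
move=> cG [_ c'0 c'G]; apply: setfunP => X; have [->|[x xX]] := set_0Vmem X.
  by case: cG => _ -> _.
have := congr1 (fun g : E => g X) (log_rho_uniq cG (c'G x)).
by rewrite !rhoE xX.
Qed.

(** Both factors are multiples of the same square-zero symbol. *)
Lemma mul_supp a g h : rho a g = g -> rho a h = h -> g * h = 0.
Proof.
move=> ga ha; rewrite -[RHS](mul0r h); apply: setfun_mul_eq => Y Z dYZ.
rewrite -[in LHS]ga -[in LHS]ha !rhoE setfun0 mul0r; case: ifP => aY;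
  last exact: mul0r.
by rewrite (disjointFr dYZ) ?mulr0.
Qed.

(** The sets that satisfy Q are closed under disjoint unions and under parts,
    so no value of g or h outside Q contributes to a set in Q, or conversely. *)
Lemma mul_restr (Q : pred {set 'I_N}) g h :
  (forall Y Z, Y :&: Z = set0 -> Q (Y :|: Z) = Q Y && Q Z) ->
  restr Q (g * h) = restr Q g * restr Q h.
Proof.
move=> QU; apply: setfunP => X; rewrite restrE !setfunM; case: ifP => QX.
  apply: eq_bigr => Y sYX; rewrite !restrE.
  have := QU Y (X :\: Y);
    rewrite setIDA setIC -setIDA setDv setI0 => /(_ erefl).
  by rewrite -{1}(setIidPr sYX) setID QX => /esym/andP[-> ->].
rewrite big1 // => Y sYX; rewrite !restrE.
have := QU Y (X :\: Y); rewrite setIDA setIC -setIDA setDv setI0 => /(_ erefl).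
rewrite -{1}(setIidPr sYX) setID QX.
by case: (Q Y) => /= [<-|_]; rewrite ?mulr0 ?mul0r scaler0.
Qed.

Section Merge.
Variables (a b : 'I_N).

Definition avoid X := (a \notin X) && (b \notin X).
Definition both_or_none X := (a \in X) == (b \in X).

(** The logarithm after a and b are glued: a connected contribution to the
    glued point is a connected set that contains both a and b, or two connected
    sets joined at the new point. *)
Definition merge_log c : E :=
  restr avoid c + (rho a (rho b c) + rho a c * rho b c).

Lemma avoidM g h : restr avoid (g * h) = restr avoid g * restr avoid h.
Proof.
by apply: mul_restr => Y Z _; rewrite /avoid !inE !negb_or;
  do 4!case: (_ \in _).
Qed.

Lemma rho_id x g : rho x (rho x g) = rho x g.
Proof. by apply: setfunP => X; rewrite !rhoE; case: (x \in X). Qed.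

Lemma rhoC x y g : rho x (rho y g) = rho y (rho x g).
Proof. exact: restrC. Qed.

Lemma rho_restr x Q g : rho x (restr Q g) = restr Q (rho x g).
Proof. exact: restrC. Qed.

Lemma mul_avoid r g : rho a r = r -> rho b r = r -> r * g = r * restr avoid g.
Proof.
move=> ra rb; apply: setfun_mul_eq => Y Z dYZ;
  rewrite -[in LHS]ra -[in RHS]ra !rhoE.
case: ifP => aY; last by rewrite !mul0r.
rewrite -[in LHS]rb -[in RHS]rb !rhoE; case: ifP => bY; last by rewrite !mul0r.
by rewrite restrE /avoid (disjointFr dYZ aY) (disjointFr dYZ bY).
Qed.

(** With r the sum of the two new terms, applying rho b and then rho a to
    G = exp c gives rho a (rho b G) = r * G, so the part of G on the sets
    that contain both or none of a and b is (1 + r) * exp (restr avoid c).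
    As r is a multiple of the symbol of a, r squared is zero and
    1 + r = exp r. *)
Lemma merge_logP G c : is_log G c -> is_log (restr both_or_none G)
  (merge_log c).
Proof.
move=> [G0 c0 cG]; set r := rho a (rho b c) + rho a c * rho b c.
have ra : rho a r = r.
  rewrite /r raddfD /= rhoM !rho_id; congr (_ + _).
  by rewrite [X in _ + X](mul_supp (a := a)) ?rho_id ?addr0.
have rb : rho b r = r.
  have rab : rho b (rho a (rho b c)) = rho a (rho b c) by rewrite rho_restr
    rho_id.
  rewrite /r raddfD /= rhoM rab !rho_id; congr (_ + _).
  rewrite [X in X + _](mul_supp (a := b)) ?rho_id ?add0r //.
(* r only meets the part of G on the sets that avoid a and b. *)
have rG : rho a (rho b G) = r * restr avoid G.
  rewrite -mul_avoid // cG rhoM cG mulrDl mulrA.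
  by rewrite [rho b c * _]mulrC.
have -> : restr both_or_none G = (1 + r) * restr avoid G.
  rewrite mulrDl mul1r -rG; apply: setfunP => X.
  rewrite setfunD !restrE /both_or_none /avoid.
  by case: (a \in X); case: (b \in X); rewrite /= ?addr0 ?add0r.
have r0 : r set0 = 0 by rewrite -ra rhoE in_set0.
split=> [||x].
- by rewrite setfunM_set0 setfunD setfun1 eqxx r0 addr0 mul1r restrE /avoid
  !inE.
- by rewrite setfunD r0 addr0 restrE c0 if_same.
have rr : rho x r * r = 0.
  by apply: (mul_supp (a := a)) => //; rewrite rhoC ra.
rewrite rhoM raddfD /= rho1 add0r rho_restr cG avoidM.
rewrite /merge_log -/r.
have -> : rho x (restr avoid c + r) = rho x (restr avoid c) + rho x r.
  exact: raddfD.
rewrite [RHS]mulrDl [LHS]addrC; congr (_ + _).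
  by rewrite mulrCA rho_restr.
by rewrite mulrA mulrDr mulr1 rr addr0.
Qed.

(** The weight v' is v with b no longer counted.  In the product
    rho a c * rho b c the orders add up to at least
    (v Y - 1) + (v Z - 1) = v' X - 1 for X = Y :|: Z, because Z contains b. *)
Lemma merge_log_tmod0 c (v v' : {set 'I_N} -> nat) :
  (forall Y Z, [disjoint Y & Z] -> v (Y :|: Z) = v Y + v Z)%N ->
  (forall X, v X = v' X + (b \in X))%N ->
  (forall X, tmod0 (v X).-1 (c X)) ->
  forall X, tmod0 (v' X).-1 (merge_log c X).
Proof.
move=> vD vv' cv X; rewrite setfunD; apply: tmod0D.
  rewrite restrE; case: ifP => // /andP[_ /negPf bX].
  by have := cv X; rewrite vv' bX addn0.
rewrite setfunD; apply: tmod0D.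
  rewrite !rhoE; do 2!case: ifP => // _; apply: tmod0W (cv X).
  by rewrite vv'; case: (b \in X); lia.
rewrite setfunM; apply: tmod0_sum => Y sYX; apply: tmod0Z; rewrite !rhoE.
case: ifP => aY; last by rewrite mul0r.
case: ifP => bZ; last by rewrite mulr0.
apply: tmod0W (tmod0M (cv Y) (cv (X :\: Y))).
have := vD Y (X :\: Y) (disjointDr _ _); rewrite -{1}(setIidPr sYX) setID.
rewrite (vv' X) (vv' (X :\: Y)) bZ.
by move: bZ; rewrite inE => /andP[_ ->]; lia.
Qed.
End Merge.

(** Each b in l is glued to s b; the elements outside l keep weight one. *)
Lemma merge_list (s : 'I_N -> 'I_N) G c (l : seq 'I_N) : is_log G c ->
  (forall X, tmod0 #|X|.-1 (c X)) -> uniq l ->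
  exists2 c', is_log (restr (fun X => all (fun b => (s b \in X) == (b \in X)) l)
    G) c'
    & forall X, tmod0 #|[set x in X | x \notin l]|.-1 (c' X).
Proof.
move=> cG cv; elim: l => [|b l IH] /= => [_|/andP[bl /IH[c' c'G c'v]]].
  exists c; last by move=> X; have -> : [set x in X | x \notin [::]] = X
    by apply/setP => x; rewrite !inE andbT.
  by have -> : restr (fun=> true) G = G by exact: setfunP.
exists (merge_log (s b) b c').
  have -> : restr (fun X => ((s b \in X) == (b \in X)) &&
                all (fun b => (s b \in X) == (b \in X)) l) G =
    restr (both_or_none (s b) b) (restr
      (fun X => all (fun b => (s b \in X) == (b \in X)) l) G).
    apply: setfunP => X; rewrite !restrE /both_or_none.
    by case: ((s b \in X) == (b \in X)); case: (all _ l).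
  exact: merge_logP.
apply: (@merge_log_tmod0 _ _ _ (fun X => #|[set x in X | x \notin l]|)
  (fun X => #|[set x in X | x \notin b :: l]|)) => // [Y Z dYZ|X].
  rewrite -cardsUI -[LHS]addn0; congr (_ + _)%N.
    by congr #|pred_of_set _|; apply/setP => x; rewrite !inE andb_orl.
  symmetry; apply/eqP; rewrite cards_eq0; apply/eqP/setP => x; rewrite !inE.
  by case xY : (x \in Y); rewrite //= (disjointFr dYZ xY) andbF.
rewrite [in LHS](cardsD1 b) addnC; congr (_ + _)%N;
  last by rewrite !inE bl andbT.
by congr #|pred_of_set _|; apply/setP => x; rewrite !inE negb_or andbCA.
Qed.
End SetFunLog.

(** * Moebius inversion over set partitions *)
Section PartitionFormula.
Variables (I : finType) (C : comPzRingType) (alpha : {set I} -> C).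
Hypothesis alpha0 : alpha set0 = 1.
Hypothesis alphaM : forall X Y, X :&: Y != set0 -> alpha X * alpha Y = 0.
Implicit Types (X Y Z T : {set I}) (P Q : {set {set I}}).

(** For nonempty X, the part at X of the logarithm of the sum of all alpha Y. *)
Definition mobius_sum X : C := \sum_(P : {set {set I}} | partition P X)
  (-1) ^+ #|P|.-1 * (\prod_(Y in P) alpha Y) *+ (#|P|.-1)`!.

Lemma mobius_sumM X Z : X :&: Z != set0 -> mobius_sum X * alpha Z = 0.
Proof.
case/set0Pn => x; rewrite inE => /andP[xX xZ]; rewrite /mobius_sum mulr_suml.
apply: big1 => P pP.
have xB : x \in cover P by rewrite (cover_partition pP).
rewrite (big_setD1 (pblock P x)) ?pblock_mem //= mulrnAl -!mulrA.
rewrite [X in _ * (_ * X)]mulrC [X in _ * X]mulrA alphaM ?mul0r ?mulr0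
  ?mul0rn //.
by apply/set0Pn; exists x; rewrite inE xZ mem_pblock xB.
Qed.

(** Adding the block Z turns the partitions of T :\: Z into the partitions of
    T that have Z as a block. *)
Lemma mobius_sum_block T Z : Z != set0 -> Z \subset T ->
  mobius_sum (T :\: Z) * alpha Z =
  \sum_(Q : {set {set I}} | partition Q T && (Z \in Q))
    (-1) ^+ #|Q|.-2 * (\prod_(Y in Q) alpha Y) *+ (#|Q|.-2)`!.
Proof.
move=> Z0 sZT; rewrite /mobius_sum mulr_suml.
rewrite (reindex_onto (fun Q => Q :\ Z) (fun P => Z |: P)) /=; last first.
  move=> P pP; rewrite setU1K //; apply/negP => ZP.
  have := partitionS pP ZP; rewrite subsetD => /andP[_].
  by rewrite -setI_eq0 setIid (negPf Z0).
apply: eq_big => [Q|Q /andP[pQ /eqP ZQ]]; last first.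
  have ZinQ : Z \in Q by rewrite -ZQ setU11.
  rewrite mulrnAl -mulrA [in RHS](big_setD1 Z) //= [alpha Z * _]mulrC.
  by rewrite [in RHS](cardsD1 Z) ZinQ.
apply/andP/andP => [[pQ /eqP ZQ]|[pQ ZQ]]; last first.
  by rewrite partitionD1 // setD1K.
split; last by rewrite -ZQ setU11.
rewrite -ZQ -[T](setID T Z) (setIidPr sZT) partitionU1 //.
by rewrite disjoint_sym disjoints_subset subsetDr.
Qed.

(** A partition Q of T with m blocks comes from Z = set0, with coefficient
    (-1)^(m-1) (m-1)!, and from each of its m - 1 blocks that avoid x, with
    coefficient (-1)^(m-2) (m-2)!.  These cancel unless m = 1. *)
Lemma mobius_sum_rec T x : x \in T ->
  \sum_(Z : {set I} | (Z \subset T) && (x \notin Z)) mobius_sum (T :\: Z) *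
    alpha Z =
  alpha T.
Proof.
move=> xT; rewrite (bigD1 set0) ?sub0set ?inE //= setD0 alpha0 mulr1.
transitivity (mobius_sum T + \sum_(Q : {set {set I}} | partition Q T)
   ((-1) ^+ #|Q|.-2 * (\prod_(Y in Q) alpha Y) *+ (#|Q|.-2)`!) *+ #|Q|.-1).
  congr (_ + _).
  rewrite
    (eq_bigr (fun Z => \sum_(Q : {set {set I}} | partition Q T && (Z \in Q))
    (-1) ^+ #|Q|.-2 * (\prod_(Y in Q) alpha Y) *+ (#|Q|.-2)`!)); last first.
    by move=> Z /andP[/andP[sZT _] Z0]; exact: mobius_sum_block.
  rewrite (exchange_big_dep (fun Q => partition Q T)) /=; last first.
    by move=> Z Q _ /andP[].
  apply: eq_bigr => Q pQ; rewrite sumr_const; congr (_ *+ _).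
  have xQ : x \in cover Q by rewrite (cover_partition pQ).
  rewrite (cardsD1 (pblock Q x)) pblock_mem //= -cardsE.
  congr #|pred_of_set _|; apply/setP => Z;
    rewrite !inE pQ /= [LHS]unfold_in /= andbC.
  case ZQ : (Z \in Q); rewrite ?andbF //= andbT.
  rewrite (partitionS pQ ZQ) (partition_neq0 pQ ZQ) andbT /=; congr negb.
  apply/idP/eqP => [xZ|->]; last by rewrite mem_pblock.
  by rewrite (def_pblock (partition_trivIset pQ) ZQ xZ).
rewrite /mobius_sum -big_split /= (bigD1 [set T]) /=; last first.
  rewrite /partition /cover big_set1 eqxx trivIset1 inE eq_sym /=.
  by apply/set0Pn; exists x.
rewrite cards1 big_set1 /= mulr0n addr0 mul1r mulr1n.
rewrite [X in _ + X]big1 ?addr0 // => Q /andP[pQ Q1].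
have : #|Q| != 0%N.
  rewrite cards_eq0; apply: contraTneq xT => Q0.
  by rewrite -(cover_partition pQ) Q0 /cover big_set0 inE.
have : #|Q| != 1%N.
  apply: contraNneq Q1 => /eqP/cards1P[Y QY].
  by move: (cover_partition pQ); rewrite QY /cover big_set1 => ->.
case: #|Q| => [|[|m]] //= _ _.
by rewrite -mulrnA [(m`! * _)%N]mulnC -factS exprS mulN1r mulNr mulNrn addNr.
Qed.

(** Summing the recursion over all T that contain x gives the differential
    equation of the exponential. *)
Lemma mobius_log x :
  \sum_(X : {set I} | x \in X) alpha X =
  (\sum_(X : {set I} | x \in X) mobius_sum X) * \sum_Z alpha Z.
Proof.
under eq_bigr => T xT do rewrite -(mobius_sum_rec xT).
rewrite mulr_sumr (exchange_big_dep predT) //=; apply: eq_bigr => Z _.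
rewrite mulr_suml; symmetry.
rewrite (bigID (fun X => X :&: Z == set0)) /= addrC big1 ?add0r; last first.
  by move=> X /andP[_ XZ]; exact: mobius_sumM.
rewrite (reindex_onto (fun T => T :\: Z) (fun X => X :|: Z)) /=; last first.
  move=> X /andP[_ /eqP XZ]; rewrite setDUl setDv setU0.
  by apply/setDidPl; rewrite -setI_eq0 XZ.
apply: eq_bigl => T;
  rewrite inE setDE -setIA [~: Z :&: Z]setIC setICr setI0 eqxx andbT.
case xT : (x \in T); rewrite ?andbF //= andbT andbC.
congr (_ && _); apply/eqP/idP => [<-|/setIidPr sZT]; first by rewrite subsetUr.
by rewrite -setDE -[X in _ :|: X]sZT setUC setID.
Qed.
End PartitionFormula.

(** * Cumulants as logarithms *)
Lemma odd_count (I : Type) (p : pred I) (s : seq I) :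
  odd (count p s) = \big[addb/false]_(i <- s) p i.
Proof.
by elim: s => [|i s IH]; rewrite ?big_nil // big_cons /= oddD IH oddb.
Qed.

Lemma odd_kparity_cat n (d : 'I_n -> int) (v u : seq 'I_n) :
  pairwise (fun i j : 'I_n => i < j)%N v ->
  odd (kparity d (v ++ u)) =
    (\big[addb/false]_(y <- v) \big[addb/false]_(z <- u) inversion_par d y z)
      (+) odd (kparity d u).
Proof.
elim: v => [|i v IH] /=; first by rewrite big_nil.
case/andP => /allP iv /IH E; rewrite oddD E big_cons addbA;
  congr (_ (+) _ (+) _).
rewrite count_cat oddD !odd_count big_seq big1 => [|j /iv ij]; last first.
  by rewrite ltnNge (ltnW ij).
by [].
Qed.

Lemma enum_pairwise n (X : {set 'I_n}) : pairwise (fun i j : 'I_n => i < j)%N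
  (enum X).
Proof.
rewrite {1}/enum_mem; apply: pairwise_filter; rewrite -enumT.
rewrite -(pairwise_map (fun i : 'I_n => (i : nat)) ltn) val_enum_ord.
by rewrite -sorted_pairwise ?iota_ltn_sorted //; exact: ltn_trans.
Qed.

(** Below, the letters 0, ..., N-1 are grouped into n consecutive words by the
    monotone map p, and s chooses a letter in each word. *)
Section Blocks.
Variables (N n : nat) (p : 'I_N -> 'I_n) (s : 'I_n -> 'I_N).
Hypothesis p_mono : forall x y : 'I_N, (x <= y)%N -> (p x <= p y)%N.
Hypothesis sK : cancel s p.
Variables (e : 'I_N -> int) (d : 'I_n -> int).
Hypothesis oddz_d : forall i, oddz (d i) = oddz (wt e (p @^-1: [set i])).
Implicit Types (X U : {set 'I_n}) (Y : {set 'I_N}).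

(** Letters of different words compare as the words do, and the parity of a
    word is the sum of the parities of its letters. *)
Lemma shuffle_par_preim X U : [disjoint X & U] ->
  shuffle_par e (p @^-1: X) (p @^-1: U) = shuffle_par d X U.
Proof.
move=> dXU; rewrite /shuffle_par (partition_big p (mem X)) => [|y];
  last by rewrite inE.
apply: eq_bigr => i; rewrite inE => iX; rewrite exchange_big /=.
rewrite (partition_big p (mem U)) => [|z]; last by rewrite inE.
apply: eq_bigr => j; rewrite inE => jU.
have nij : (i : nat) != j.
  by apply: contraL jU => /eqP/val_inj <-; rewrite (disjointFr dXU).
transitivity (\big[addb/false]_(z in p @^-1: [set j])
    \big[addb/false]_(y in p @^-1: [set i])
      ((j < i)%N && (oddz (e y) && oddz (e z)))).
  apply: eq_big => [z|z /andP[_ /eqP zj]].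
    by rewrite !inE; case: eqP => [->|]; rewrite ?jU ?andbF.
  apply: eq_big => [y|y /andP[_ /eqP yi]].
    by rewrite !inE; case: eqP => [->|]; rewrite ?iX ?andbF.
  rewrite /inversion_par; congr (_ && _).
  case: (ltngtP i j) nij => // ij _; have [zy|yz] := leqP y z => //.
  - by have := p_mono (ltnW yz); rewrite zj yi leqNgt ij.
  - by have := p_mono zy; rewrite zj yi leqNgt ij.
rewrite /inversion_par !oddz_d !oddz_wt big_distrlr big_distrr exchange_big /=.
by apply: eq_bigr => y _; rewrite big_distrr.
Qed.

(** The sets of letters that are unions of words. *)
Definition saturated Y := Y == p @^-1: (s @^-1: Y).

Lemma preimK X : s @^-1: (p @^-1: X) = X.
Proof. by apply/setP => i; rewrite !inE sK. Qed.

Section Eval.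
Variables (K : fieldType) (k : int) (kodd : odd `|k|%N) (B : gcalgType K).
Variable (G : setfun kodd B e).
Hypothesis G0 : G set0 = 1.

(** The part of G on a single union of words; these parts are the summands to
    which Moebius inversion applies. *)
Definition block X : setfun kodd B e := restr (pred1 (p @^-1: X)) G.

Lemma blockE X Y : block X Y = if Y == p @^-1: X then G Y else 0.
Proof. by []. Qed.

Lemma block_set0 : block set0 = 1.
Proof.
by apply: setfunP => Y; rewrite blockE setfun1 preimset0; case: eqP => // ->.
Qed.

Lemma rho_block j X : rho j (block X) = if p j \in X then block X else 0.
Proof.
apply: setfunP => Y; rewrite rhoE blockE; case: (Y =P p @^-1: X) => [->|nY].
  by rewrite inE; case: ifP => // _; rewrite blockE eqxx.
by rewrite if_same; case: (p j \in X) => //; rewrite blockE; case: eqP.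
Qed.

Lemma blockM X X' : X :&: X' != set0 -> block X * block X' = 0.
Proof.
case/set0Pn => i; rewrite inE => /andP[iX iX'].
by apply: (mul_supp (a := s i)); rewrite rho_block sK ?iX ?iX'.
Qed.

Lemma sum_block : \sum_X block X = restr saturated G.
Proof.
apply: setfunP => Y;
  rewrite setfun_sum restrE /saturated (bigD1 (s @^-1: Y)) //=.
rewrite big1 ?addr0 // => X nX; case: eqP => // YX.
by rewrite YX preimK eqxx in nX.
Qed.

Lemma rho_sum_block j : rho j (\sum_X block X) =
  \sum_(X : {set 'I_n} | p j \in X) block X.
Proof.
rewrite raddf_sum [RHS]big_mkcond; apply: eq_bigr => X _; exact: rho_block.
Qed.

(** Only the factor whose block contains p j contributes to the derivation. *)
Lemma rho_prod_block j X (P : {set {set 'I_n}}) : partition P X ->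
  rho j (\prod_(Y in P) block Y) = if p j \in X then \prod_(Y in P) block Y else
    0.
Proof.
move=> pP; case: ifP => jX.
  have jB : p j \in cover P by rewrite (cover_partition pP).
  rewrite (big_setD1 (pblock P (p j))) ?pblock_mem //= rhoM rho_block mem_pblock
    jB.
  rewrite [X in _ + X](mul_supp (a := j)) ?addr0 //.
    by rewrite rho_block mem_pblock jB.
  by apply: setfunP => Y; rewrite !rhoE; case: (j \in Y).
apply: (big_ind (fun g => rho j g = 0)) => [|g h gj hj|Y YP].
- by rewrite -block_set0 rho_block inE.
- by rewrite rhoM gj hj mul0r mulr0 addr0.
rewrite rho_block; case: ifP => // jY.
by have /subsetP/(_ _ jY) := partitionS pP YP; rewrite jX.
Qed.

Lemma rho_mobius_sum j X : rho j (mobius_sum block X) =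
  if p j \in X then mobius_sum block X else 0.
Proof.
rewrite /mobius_sum raddf_sum.
case: ifP => jX; [apply: eq_bigr|apply: big1] => P pP.
  by rewrite raddfMn /= rhoM (rho_prod_block j pP) jX rho_sign mul0r add0r.
by rewrite raddfMn /= rhoM (rho_prod_block j pP) jX rho_sign mul0r mulr0 addr0
  mul0rn.
Qed.

Definition block_log : setfun kodd B e :=
  \sum_(X : {set 'I_n} | X != set0) mobius_sum block X.

Lemma block_logP : is_log (restr saturated G) block_log.
Proof.
split=> [||j].
- by rewrite restrE /saturated !preimset0 eqxx.
- rewrite setfun_sum big1 // => X /set0Pn[i iX].
  by have := rho_mobius_sum (s i) X; rewrite sK iX => <-; rewrite rhoE inE.
rewrite -sum_block rho_sum_block (mobius_log block_set0 blockM); congr (_ * _).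
rewrite /block_log raddf_sum /= [RHS]big_mkcond [LHS]big_mkcond.
apply: eq_bigr => X _; rewrite rho_mobius_sum; case: ifP => jX;
  last by rewrite if_same.
by case: eqP => // X0; rewrite X0 inE in jX.
Qed.

(** The Moebius sum of X lives on the letters of the words in X, and these are
    all the letters only when X is everything. *)
Lemma block_logT : (0 < n)%N -> block_log setT = mobius_sum block setT setT.
Proof.
move=> n0; rewrite setfun_sum (bigD1 setT) /=; last first.
  by apply/set0Pn; exists (Ordinal n0); rewrite inE.
rewrite big1 ?addr0 // => X /andP[_]; rewrite -properT => /properP[_ [i _ iX]].
have := congr1 (fun g : setfun kodd B e => g setT) (rho_mobius_sum (s i) X).
by rewrite sK (negPf iX) rhoE inE.
Qed.

(** The product in the ring of set functions produces the same sign as the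
    enumeration of the blocks one after the other, whatever their order. *)
Lemma prod_block (t : seq {set 'I_n}) :
  uniq (flatten [seq enum X | X : {set 'I_n} <- t]) ->
  (\prod_(X <- t) block X)
    (p @^-1: [set i in flatten [seq enum X | X : {set 'I_n} <- t]]) =
  (-1) ^+ kparity d (flatten [seq enum X | X : {set 'I_n} <- t]) *:
    \prod_(X <- t) G (p @^-1: X).
Proof.
elim: t => [_|X t IH] /=.
  rewrite !big_nil expr0 scale1r setfun1; case: eqP => // /eqP/set0Pn[j].
  by rewrite !inE.
set u := flatten _ in IH *; rewrite cat_uniq => /and3P[_ /hasPn Xu uu].
have dXU : [disjoint X & [set i in u]].
  rewrite disjoint_sym disjoints_subset; apply/subsetP => i.
  by rewrite !inE => /Xu; rewrite mem_enum.
have -> : [set i in enum X ++ u] = X :|: [set i in u].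
  by apply/setP => i; rewrite !inE mem_cat mem_enum.
have dpre : [disjoint p @^-1: X & p @^-1: [set i in u]].
  rewrite disjoints_subset; apply/subsetP => j; rewrite !inE => jX.
  by have := disjointFr dXU jX; rewrite inE => ->.
rewrite !big_cons setfunM preimsetU (bigD1 (p @^-1: X)) ?subsetUl //=.
rewrite [X in _ + X]big1 ?addr0 => [|Y /andP[_ /negPf nY]]; last first.
  by rewrite nY mul0r scaler0.
rewrite eqxx (setD_part dpre erefl) IH // -pserM_scalerAr scalerA
  shuffle_par_preim //.
congr (_ *: _); rewrite -[in RHS]signr_odd odd_kparity_cat ?enum_pairwise //.
rewrite signr_addb signr_odd; congr ((-1) ^+ nat_of_bool _ * _).
rewrite /shuffle_par big_enum; apply: eq_bigr => i _.
by rewrite [RHS]big_uniq //; apply: eq_bigl => j; rewrite inE.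
Qed.

(** The general form, in which each argument a i is a word of letters, lets the
    cumulant be compared with a logarithm computed on the letters. *)
Lemma cumulant_log (R : pzRingType) (f : R -> pser B) (a : 'I_n -> R)
    (c : setfun kodd B e) : (0 < n)%N ->
  (forall X, f (\prod_(i in X) a i) = G (p @^-1: X)) ->
  is_log (restr saturated G) c -> cumulant f d a = c setT.
Proof.
move=> n0 fG /log_uniq -/(_ _ block_logP) ->; rewrite (block_logT n0).
rewrite /mobius_sum setfun_sum; apply: eq_bigr => P pP.
rewrite setfunMn setfun_sign; congr (_ *+ _).
have fl : [set i in flatten [seq enum X | X : {set 'I_n} <- enum P]] = setT.
  apply/setP => i; rewrite !inE; apply/flatten_mapP.
  have : i \in cover P by rewrite (cover_partition pP) inE.
  by case/bigcupP => X XP iX; exists X; rewrite mem_enum.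
(* The blocks cover the n indices and their sizes add up to n. *)
have uf : uniq (flatten [seq enum X | X : {set 'I_n} <- enum P]).
  rewrite (uniq_size_uniq (enum_uniq 'I_n)) => [|i]; last first.
    by rewrite mem_enum; have := in_setT i; rewrite -fl inE => ->.
  rewrite size_flatten /shape -map_comp sumnE big_map big_enum /= -cardE
    card_ord.
  rewrite -[X in _ == X]card_ord -cardsT (card_partition pP).
  by apply/eqP; apply: eq_bigr => X _; rewrite cardE.
have := prod_block uf; rewrite fl preimsetT big_enum => ->.
rewrite signr_scale exprD scalerA; congr (_ *: _).
by apply: eq_bigr => X _; exact: fG.
Qed.
End Eval.
End Blocks.

(** * The convolution exponential *)
Section ConvHomog.
Variables (K : fieldType) (k : int) (U : int -> lmodType K) (B : gcalgType K).
Implicit Types (F G : symalg U -> pser B) (w : seq (letter U)).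

Lemma coprod_wdeg w s : s \in coprod w -> wdeg w = wdeg s.1.2 + wdeg s.2.
Proof.
elim: w s => [|x w IH] s /=.
  by rewrite inE => /eqP ->; rewrite /wdeg big_nil.
rewrite mem_cat => /orP[] /mapP[r /IH E ->] /=; rewrite !wdeg_cons E.
  by rewrite addrA.
by rewrite addrCA.
Qed.

Lemma homog_sprod w : homog (wdeg w) (sprod w : symalg U).
Proof. by apply: sspan_sprod; rewrite /= eqxx. Qed.

(** A linear map is determined by its values on words, and so is its degree. *)
Lemma hom0_words F : linear F ->
  (forall w, pser_homog k (wdeg w) (F (sprod w))) ->
  hom0 k (F : (symalg U : gcalgType K) -> pser B).
Proof.
move=> Flin Fw; split=> // d x; elim/sspan_ind: x / => [|c w x /eqP wd IH].
  have -> : F 0 = 0; last exact: pser_homog0.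
  by have := GRing.zmod_morphism_linear Flin 0 0; rewrite !subrr.
by rewrite Flin; apply: pser_homogP => //; rewrite -wd.
Qed.

Lemma hom0_conv F G : hom0 k F -> hom0 k G -> hom0 k (conv F G).
Proof.
move=> [Fl Fh] [Gl Gh]; apply: (hom0_words (conv_linear Fl Gl)) => w.
rewrite convE // big_seq; apply: pser_homog_sum => s sw; apply: pser_homogZ.
by rewrite (coprod_wdeg sw); apply: pser_homogM; [apply: Fh | apply: Gh];
  exact: homog_sprod.
Qed.

Lemma hom0_conv_exp F m : hom0 k F -> hom0 k (conv_exp F m).
Proof.
move=> Fh; elim: m => [|m IH]; last exact: hom0_conv.
apply: hom0_words => [|w]; first exact: conv_unit_linear.
rewrite /= conv_unitE; case: w => [|x w]; last exact: pser_homog0.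
by rewrite /wdeg big_nil; exact: pser_homog1.
Qed.

(** The bound M on the order may be chosen independently of w, which makes it
    uniform over the subwords of a given word. *)
Lemma exp_star_sprod F M w : linear F -> F 1 = 0 -> (size w < M)%N ->
  exp_star F (sprod w) = \sum_(m < M) (m`!%:R)^-1 *: conv_exp F m (sprod w).
Proof.
move=> Flin F1 wM; rewrite [LHS](slift_sprod (exp_star_gsym Flin)).
rewrite (big_ord_widen _ (fun m => (m`!%:R)^-1 *: conv_exp F m (sprod w)) wM).
rewrite big_mkcond; apply: eq_bigr => m _; case: ltnP => // lt.
by rewrite (conv_exp_vanish Flin F1 lt) scaler0.
Qed.

Lemma hom0_exp_star F : F 1 = 0 -> hom0 k F -> hom0 k (exp_star F).
Proof.
move=> F1 Fh; have [Fl _] := Fh; apply: (hom0_words (exp_star_linear Fl)) => w.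
rewrite (exp_star_sprod Fl F1 (ltnSn _)); apply: pser_homog_sum => m _.
by apply: pser_homogZ; case: (hom0_conv_exp m Fh) => _; apply;
  exact: homog_sprod.
Qed.

Lemma exp_star1 F : linear F -> exp_star F 1 = 1.
Proof.
move=> Fl; rewrite -sprod_nil [LHS](slift_sprod (exp_star_gsym Fl)) big_ord1.
by rewrite invr1 scale1r /= conv_unitE.
Qed.
End ConvHomog.

Lemma filter_enum (T : finType) (X : {set T}) (p : pred T) :
  [seq j <- enum X | p j] = enum [set j in X | p j].
Proof.
by rewrite {1}/enum_mem -filter_predI; apply: eq_filter => j;
  rewrite !inE andbC.
Qed.

Section Restrict.
Variables (K : fieldType) (U : int -> lmodType K).
Variables (N : nat) (W : 'I_N -> letter U).
Implicit Types (X Y Z : {set 'I_N}).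

Definition ldeg (j : 'I_N) : int := tag (W j).
Definition subword X : seq (letter U) := [seq W j | j <- enum X].

Lemma wdeg_map (v : seq 'I_N) : uniq v -> wdeg (map W v) = wt ldeg [set j in v].
Proof.
move=> uv; rewrite /wdeg big_map big_uniq // /wt.
by apply: eq_bigl => j; rewrite inE.
Qed.

Lemma wdeg_subword X : wdeg (subword X) = wt ldeg X.
Proof. by rewrite wdeg_map ?enum_uniq // set_enum. Qed.

Lemma size_subword X : size (subword X) = #|X|.
Proof. by rewrite size_map -cardE. Qed.

(** The unshuffles of a word correspond to the subsets Y of its positions.  The
    first letter x contributes no sign when it goes left, and it passes the
    letters of Y when it goes right. *)
Lemma cosum_sets (V : lmodType K) (b : seq (letter U) -> seq (letter U) -> V)
    (v : seq 'I_N) : pairwise (fun i j : 'I_N => i < j)%N v ->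
  cosum b (map W v) = \sum_(Y : {set 'I_N} | Y \subset [set j in v])
    (-1) ^+ shuffle_par ldeg Y ([set j in v] :\: Y) *:
      b (map W [seq j <- v | j \in Y]) (map W [seq j <- v | j \notin Y]).
Proof.
elim: v b => [|x v IH] b.
  rewrite (big_pred1 set0) => [|Y]; last by rewrite set_nil subset0.
  by rewrite /cosum big_seq1 set_nil setD0 shuffle_par0l.
rewrite /= => /andP[/allP xv pv].
set S := [set j in v].
have Sx : [set j in x :: v] = x |: S by apply/setP => j; rewrite !inE.
have xS j : j \in S -> (x < j)%N by rewrite inE => /xv.
have nxv : x \notin v by apply/negP => /xv; rewrite ltnn.
have nxS : x \notin S by rewrite inE.
have uv : uniq v.
  by apply: pairwise_uniq pv => i; rewrite ltnn.
rewrite cosum_cons !IH // Sx [RHS](bigID (fun Y : {set 'I_N} => x \in Y)) /=.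
congr (_ + _).
  rewrite [RHS](reindex_onto (fun Y => x |: Y) (fun Y => Y :\ x)) /=;
    last first.
    by move=> Y /andP[_ xY]; rewrite setD1K.
  have eqY Y : (x |: Y \subset x |: S) && (x \in x |: Y) &&
    ((x |: Y) :\ x == Y) =
      (Y \subset S).
    apply/idP/idP => [/andP[/andP[sY _] /eqP YE]|sY].
      by rewrite -YE; apply/subsetP => j; rewrite !inE;
        move/subsetP: sY => /(_ j);
         rewrite !inE; case: eqP.
    have nxY : x \notin Y by apply: contra nxS; exact: (subsetP sY).
    by rewrite setUS // setU11 setU1K // eqxx.
  apply: eq_big => [Y|Y sY]; first by rewrite eqY.
  have nxY : x \notin Y by apply: contra nxS; exact: (subsetP sY).
  have -> : (x |: S) :\: (x |: Y) = S :\: Y.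
    by apply/setP => j; rewrite !inE; case: eqP => [->|] //=;
      rewrite (negPf nxv) andbF.
  rewrite shuffle_parUl ?disjoints1 // setU11 /=.
  have -> : shuffle_par ldeg [set x] (S :\: Y) = false.
    rewrite /shuffle_par big_set1 big1 // => z; rewrite inE => /andP[_ /xS xz].
    by rewrite /inversion_par ltnNge (ltnW xz).
  congr (_ *: b (_ :: map W _) (map W _)); apply: eq_in_filter => j jv;
    rewrite !inE; by case: eqP jv nxv => // -> ->.
apply: eq_big => [Y|Y sY].
  apply/idP/andP => [sY|[sY xY]].
    split; last by apply: contra nxS; exact: (subsetP sY).
    by apply: subset_trans sY _; exact: subsetUr.
  apply/subsetP => j jY; have /subsetP/(_ j jY) := sY.
  by rewrite in_setU1 => /orP[/eqP jx|//]; rewrite -jx jY in xY.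
have nxY : x \notin Y by apply: contra nxS; exact: (subsetP sY).
have -> : (x |: S) :\: Y = x |: (S :\: Y).
  by apply/setP => j; rewrite !inE; case: eqP => [->|] //=; rewrite (negPf nxY).
rewrite shuffle_parUr; last by rewrite disjoints1 !inE (negPf nxv) andbF.
rewrite (negPf nxY) /= scalerA -signr_addb addbC;
  congr ((-1) ^+ nat_of_bool (_ (+) _) *: _).
rewrite /wpar wdeg_map ?filter_uniq //.
have -> : [set j in [seq j <- v | j \in Y]] = Y.
  apply/setP => j; rewrite inE mem_filter; case jY : (j \in Y) => //=.
  by have /subsetP/(_ j jY) := sY; rewrite inE.
rewrite /shuffle_par oddz_wt big_distrr; apply: eq_bigr => y yY /=.
by rewrite big_set1 /inversion_par (xS y (subsetP sY y yY)) andbC.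
Qed.

Lemma cosum_subword (V : lmodType K) (b : seq (letter U) -> seq (letter U) -> V)
  X :
  cosum b (subword X) = \sum_(Y : {set 'I_N} | Y \subset X)
    (-1) ^+ shuffle_par ldeg Y (X :\: Y) *: b (subword Y) (subword (X :\: Y)).
Proof.
rewrite cosum_sets ?enum_pairwise //.
rewrite set_enum; apply: eq_bigr => Y sYX; rewrite !filter_enum.
have -> : [set j in X | j \in Y] = Y by rewrite -[LHS]/(X :&: Y);
  apply/setIidPr.
have -> // : [set j in X | j \notin Y] = X :\: Y.
by apply/setP => j; rewrite !inE andbC.
Qed.

Section Hat.
Variables (k : int) (kodd : odd `|k|%N) (B : gcalgType K).
Implicit Types (F G : symalg U -> pser B).

Fact hat_subproof F (hF : hom0 k F) X : pser_homog k (wt ldeg X)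
  (F (sprod (subword X))).
Proof. by rewrite -wdeg_subword; apply: (proj2 hF); exact: homog_sprod. Qed.
(** The values of F on the subwords of W. *)
Definition hat F (hF : hom0 k F) : setfun kodd B ldeg :=
  SetFun kodd (hat_subproof hF).

Lemma hatE F (hF : hom0 k F) X : hat hF X = F (sprod (subword X)).
Proof. by []. Qed.

(** The reason for the twisted product of set functions. *)
Lemma hat_conv F G (hF : hom0 k F) (hG : hom0 k G) (hFG : hom0 k (conv F G)) :
  hat hFG = hat hF * hat hG.
Proof.
apply: setfunP => X; rewrite setfunM hatE.
have [Fl _] := hF; have [Gl _] := hG; rewrite convE //.
exact: (cosum_subword (fun u v => F (sprod u) * G (sprod v))).
Qed.

Lemma hat_conv_exp F (hF : hom0 k F) m (hm : hom0 k (conv_exp F m)) :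
  hat hm = hat hF ^+ m.
Proof.
elim: m hm => [|m IH] hm;
  last by rewrite exprS -(IH (hom0_conv_exp m hF)) -hat_conv.
rewrite expr0; apply: setfunP => X; rewrite hatE /= conv_unitE.
by rewrite -cards_eq0 -size_subword; case: (subword X).
Qed.

Fact setfun_const_subproof (c : K) X :
  pser_homog k (wt ldeg X) (if X == set0 then c *: (1 : pser B) else 0).
Proof.
case: eqP => [->|_]; last exact: pser_homog0.
by rewrite wt0; apply: pser_homogZ; exact: pser_homog1.
Qed.
Definition setfun_const c : setfun kodd B ldeg :=
  SetFun kodd (setfun_const_subproof c).

Lemma setfun_constM c (g : setfun kodd B ldeg) X : (setfun_const c * g) X =
  c *: g X.
Proof.
rewrite setfunM (bigD1 set0) ?sub0set //= eqxx setD0 shuffle_par0l scale1r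
  -pserM_scalerAl mul1r.
by rewrite big1 ?addr0 // => Y /andP[_ /negPf ->]; rewrite mul0r scaler0.
Qed.

Lemma hat_exp_star F (hF : hom0 k F) (hE : hom0 k (exp_star F)) M : F 1 = 0 ->
  (N < M)%N -> hat hE = \sum_(m < M) setfun_const (m`!%:R)^-1 * hat hF ^+ m.
Proof.
move=> F1 NM; apply: setfunP => X; rewrite hatE (@exp_star_sprod _ _ _ _ M) //;
  last 2 first.
- by case: hF.
- by rewrite size_subword (leq_ltn_trans _ NM) // -[N in (_ <= N)%N]card_ord
  max_card.
rewrite setfun_sum; apply: eq_bigr => m _.
by rewrite setfun_constM -(hat_conv_exp hF (hom0_conv_exp m hF)).
Qed.

(** Termwise differentiation of the exponential series; since
    [hat hF] is nilpotent, the series under the derivation may be written with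
    one more term than the one that comes out.  Characteristic zero is used to
      cancel m + 1 in
    (m + 1)!. *)
Lemma exp_star_log F (hF : hom0 k F) (hE : hom0 k (exp_star F)) :
  [pchar K] =i pred0 -> F 1 = 0 -> is_log (hat hE) (hat hF).
Proof.
move=> charK F1; have [Fl _] := hF.
have sub0 : subword set0 = [::] by rewrite /subword enum_set0.
split=> [||x]; first by rewrite hatE sub0 sprod_nil exp_star1.
  by rewrite hatE sub0 sprod_nil.
rewrite {1}(hat_exp_star hF hE F1 (leqnSn N.+1))
  (hat_exp_star hF hE F1 (leqnn N.+1)).
rewrite raddf_sum big_ord_recl mulr_sumr /=.
have rhoc c g : rho x (setfun_const c * g) = setfun_const c * rho x g.
  by apply: setfunP => X; rewrite setfun_constM !rhoE setfun_constM; case: ifP;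
    rewrite ?scaler0.
rewrite rhoc expr0 rho1 mulr0 add0r; apply: eq_bigr => m _.
rewrite rhoc rhoX; apply: setfunP => X; rewrite setfun_constM setfunMn.
rewrite mulrCA setfun_constM -scaler_nat scalerA; congr (_ *: _).
have fne (j : nat) : (j.+1)%:R != 0 :> K.
  by rewrite (proj1 (pcharf0P K) charK).
by rewrite factS natrM invfM mulrC mulrA mulfV ?mul1r.
Qed.
End Hat.
End Restrict.

(** * Linear extension and multilinearity *)
Section Extension.
Variables (K : fieldType) (k : int) (A B : gcalgType K).
Variable f : A -> pser B.
Hypothesis flin : linear f.

Lemma linear_fun0 : f 0 = 0.
Proof. by have := GRing.zmod_morphism_linear flin 0 0; rewrite !subrr. Qed.

Lemma linear_fun_sum (I : Type) (r : seq I) (P : pred I) (c : I -> K)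
  (x : I -> A) :
  f (\sum_(i <- r | P i) c i *: x i) = \sum_(i <- r | P i) c i *: f (x i).
Proof.
by elim/big_rec2: _ => [|i y z _ <-]; [exact: linear_fun0 | rewrite flin].
Qed.

Lemma text_pconst a : text f (pconst a) = f a.
Proof.
apply/funext => n; rewrite /text big_ord_recl subn0 big1 ?addr0 // => i _.
by rewrite /= linear_fun0.
Qed.

Lemma text_linear : linear (text f).
Proof.
move=> c x y; apply/funext => n;
  rewrite pserD pserZ /text scaler_sumr -big_split.
by apply: eq_bigr => i _; rewrite flin.
Qed.

(** Both sides are sums over the triples of exponents with sum n. *)
Lemma text_tlinear : tlinear (text f).
Proof.
move=> c x y; apply/funext => n; rewrite pserD /text.
under eq_bigr => i _ do
  rewrite pserD -[tscale c x i]scale1r flin scale1r linear_fun_sum pserD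
    pser_sum.
rewrite big_split; congr (_ + _); rewrite /= /tscale.
transitivity (\sum_(i < n.+1) \sum_(j < n.+1 | (j <= n - i)%N)
                (c j : K) *: f (x (n - i - j)%N) i).
  rewrite (reindex_inj rev_ord_inj) /=; apply: eq_bigr => i _.
  rewrite (big_ord_narrow_leq (leq_subr i n)) subSS.
  by apply: eq_bigr => j _; rewrite pserZ subKn // -ltnS.
rewrite (exchange_big_dep predT) //=; apply: eq_bigr => j _.
rewrite scaler_sumr [RHS](reindex_inj rev_ord_inj) /=.
transitivity (\sum_(i < n.+1 | (i <= n - j)%N) (c j : K) *: f (x (n - i - j)%N)
  i).
  by apply: eq_bigl => i; have := ltn_ord i; have := ltn_ord j; lia.
rewrite (big_ord_narrow_leq (leq_subr j n)); apply: eq_bigr => i _ /=.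
rewrite subSS subKn; last by rewrite -ltnS.
by rewrite -!subnDA addnC.
Qed.

Lemma text_homog : (forall d a, homog d a -> pser_homog k d (f a)) ->
  forall d x, pser_homog k d x -> pser_homog k d (text f x).
Proof.
move=> fh d x xh n; apply: homog_sumr => i _.
have -> : d + n%:Z * (k - 1) = d + i%:Z * (k - 1) + (n - i)%N%:Z * (k - 1).
  by rewrite -addrA -mulrDl -PoszD subnKC // -ltnS.
exact: fh (xh i) _.
Qed.
End Extension.

Lemma pconst_prod (A : pzRingType) (I : Type) (r : seq I) (P : pred I)
  (F : I -> A) :
  \prod_(i <- r | P i) pconst (F i) = pconst (\prod_(i <- r | P i) F i).
Proof.
elim/big_rec2: _ => // i x y _ ->; apply/funext => n.
rewrite pserM big_ord_recl subn0 big1 ?addr0 => [|j _]; last exact: mul0r.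
by case: n => [|n] //=; rewrite mulr0.
Qed.

Lemma prodr_enum (R : pzRingType) (I : finType) (X : {set I}) (F : I -> R) :
  \prod_(i in X) F i = \prod_(i <- enum X) F i.
Proof. by rewrite -[LHS]big_filter [index_enum I]unlock. Qed.

Section Multilinear.
Variable K : fieldType.

(** The unique factor that varies is at j. *)
Lemma prod_affine (A : gcalgType K) (I : eqType) (r : seq I) (j : I) (c : K)
    (h h1 h2 : I -> pser A) : uniq r -> j \in r ->
  (forall i, i != j -> h i = h1 i) -> (forall i, i != j -> h i = h2 i) ->
  h j = c *: h1 j + h2 j ->
  \prod_(i <- r) h i = c *: (\prod_(i <- r) h1 i) + \prod_(i <- r) h2 i.
Proof.
move=> ur jr e1 e2 hj; case/splitPr: jr ur => r1 r2; rewrite cat_uniq /=.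
case/and3P => _; rewrite negb_or => /andP[j1 _] /andP[j2 _].
have eqp g s : j \notin s -> (forall i, i != j -> h i = g i) ->
    \prod_(i <- s) g i = \prod_(i <- s) h i.
  move=> js e; apply: eq_big_seq => i si; rewrite e //.
  by apply: contraNneq js => <-.
rewrite !big_cat !big_cons /= (eqp h1 r1) // (eqp h2 r1) // (eqp h1 r2) //
  (eqp h2 r2) //.
by rewrite hj mulrDl mulrDr pserM_scalerAr pserM_scalerAl.
Qed.

(** In each partition, exactly one block contains j. *)
Lemma cumulant_affine (A B : gcalgType K) (f : pser A -> pser B) n
  (d : 'I_n -> int)
    (j : 'I_n) (c : K) (a a1 a2 : 'I_n -> pser A) : linear f ->
  (forall i, i != j -> a i = a1 i) -> (forall i, i != j -> a i = a2 i) ->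
  a j = c *: a1 j + a2 j ->
  cumulant f d a = c *: cumulant f d a1 + cumulant f d a2.
Proof.
move=> flin e1 e2 aj; rewrite /cumulant scaler_sumr -big_split.
apply: eq_bigr => P pP /=; rewrite -scalerMnr -mulrnDl; congr (_ *+ _).
rewrite !signr_scale scalerA [c * _]mulrC -scalerA -scalerDr; congr (_ *: _).
have jP : j \in cover P by rewrite (cover_partition pP) inE.
have eqX (b : 'I_n -> pser A) : (forall i, i != j -> a i = b i) ->
    forall X : {set 'I_n}, j \notin X -> \prod_(i in X) a i =
      \prod_(i in X) b i.
  move=> e X jX; apply: eq_bigr => i iX; apply: e.
  by apply: contraNneq jX => <-.
(* The default value 1 is never taken on the blocks of P; it makes the
   factors other than the block of j independent of a j, as [prod_affine]
   requires. *)
pose Fa (b : 'I_n -> pser A) (X : {set 'I_n}) :=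
  if (j \in X) && (X != pblock P j) then 1 else f (\prod_(i in X) b i).
have FaE b : \prod_(X <- enum P) f (\prod_(i in X) b i) =
  \prod_(X <- enum P) Fa b X.
  apply: eq_big_seq => X; rewrite mem_enum /Fa => XP; case: ifP => // /andP[jX].
  by rewrite (def_pblock (partition_trivIset pP) XP jX) eqxx.
rewrite !FaE; apply: (@prod_affine _ _ _ (pblock P j)).
- exact: enum_uniq.
- by rewrite mem_enum pblock_mem.
- move=> X nX; rewrite /Fa nX andbT; case: ifP => // /negbT jX.
  by rewrite (eqX a1).
- move=> X nX; rewrite /Fa nX andbT; case: ifP => // /negbT jX.
  by rewrite (eqX a2).
rewrite /Fa eqxx andbF -flin; congr f.
by rewrite !prodr_enum; apply: (@prod_affine _ _ _ j) => //;
   rewrite ?enum_uniq // mem_enum mem_pblock.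
Qed.

Variables (U : int -> lmodType K) (n : nat) (d : 'I_n -> int).

Definition update (a : 'I_n -> symalg U) (j : 'I_n) (x : symalg U) (i : 'I_n) :=
  if i == j then x else a i.

(** Homogeneous elements are replaced by words one argument at a time. *)
Lemma multilinear_words (Q : ('I_n -> symalg U) -> Prop) :
  (forall a j, Q (update a j 0)) ->
  (forall a j c x y, Q (update a j x) -> Q (update a j y) ->
     Q (update a j (c *: x + y))) ->
  (forall w, (forall i, wdeg (w i) = d i) -> Q (fun i => sprod (w i))) ->
  forall a, (forall i, homog (d i) (a i)) -> Q a.
Proof.
move=> Q0 QP Qw a ah.
suff H (l : seq 'I_n) b : (forall i, homog (d i) (b i)) ->
    (forall i, i \notin l -> exists2 w, wdeg w = d i & b i = sprod w) -> Q b.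
  by apply: (H (enum 'I_n)) => // i; rewrite mem_enum.
elim: l b => [|j l IH] b bh bw.
  have /fin_all_exists2[w wd bE] : forall i, exists2 w, wdeg w = d i & b i =
    sprod w.
    by move=> i; exact: bw.
  have -> : b = (fun i => sprod (w i)) by apply/funext => i; exact: bE.
  exact: Qw.
have -> : b = update b j (b j).
  by apply/funext => i; rewrite /update; case: eqP => [->|].
elim/sspan_ind: (b j) / (bh j) => [|c w x /eqP wd Qx]; first exact: Q0.
apply: QP => //; apply: IH => i; rewrite /update.
  by case: eqP => [->|_] //; rewrite -wd; exact: homog_sprod.
case: eqP => [->|/eqP ij il]; first by exists w.
by apply: bw; rewrite inE negb_or ij.
Qed.
End Multilinear.

(** * Cumulants of the exponential *)
Section Letters.
Variables (K : fieldType) (k : int) (kodd : odd `|k|%N).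
Variables (U : int -> lmodType K) (B : gcalgType K).

Lemma preimset_id (T : finType) (X : {set T}) : id @^-1: X = X.
Proof. by apply/setP => x; rewrite inE. Qed.

Lemma restr_saturated_id N (e : 'I_N -> int) (G : setfun kodd B e) :
  restr (saturated id id) G = G.
Proof.
apply: setfunP => X; rewrite restrE /saturated ifT //.
by apply/eqP/setP => x; rewrite !inE.
Qed.

Lemma sprod_flatten n (w : 'I_n -> seq (letter U)) (X : {set 'I_n}) :
  \prod_(i in X) sprod (w i) = sprod (flatten [seq w i | i <- enum X]) :> symalg
    U.
Proof.
rewrite prodr_enum; elim: (enum X) => [|i s IH] /=; first by rewrite big_nil.
by rewrite big_cons IH sprod_cat.
Qed.

Lemma homog_letter (x : letter U) : homog (tag x) (sprod [:: x] : symalg U).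
Proof. by have := homog_sprod [:: x]; rewrite /wdeg big_seq1. Qed.

(** On words of length one, the words and their letters are grouped
    trivially, so the logarithm is that of [exp_star_log]. *)
Lemma cumulant_letters (phi : symalg U -> pser B) (w : seq (letter U)) :
  let W := tnth (in_tuple w) in
  [pchar K] =i pred0 -> hom0 k phi -> phi 1 = 0 -> (0 < size w)%N ->
  cumulant (text (exp_star phi)) (ldeg W) (fun i => pconst (sprod [:: W i]))
    = phi (sprod w).
Proof.
move=> W charK hphi phi1 w0.
have hE := hom0_exp_star phi1 hphi.
have Elin : linear (exp_star phi) by case: hE.
pose G := hat W kodd hE; pose c := hat W kodd hphi.
have Gc : is_log G c by exact: exp_star_log.
have G0 : G set0 = 1 by case: Gc.
rewrite (@cumulant_log _ _ id id _ _ (ldeg W) (ldeg W) _ _ _ _ _ G _ _ _ _ c)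
  //.
- by rewrite hatE /subword enum_setT -enumT map_tnth_enum.
- by move=> i; rewrite preimset_id /wt big_set1.
- move=> X;
  rewrite pconst_prod text_pconst // (sprod_flatten (fun i => [:: W i])).
  rewrite preimset_id hatE; congr (exp_star phi (sprod _)).
  by rewrite /subword; elim: (enum X) => //= i s ->.
- by rewrite restr_saturated_id.
Qed.
End Letters.

Section Words.
Variables (K : fieldType) (k : int) (kodd : odd `|k|%N).
Variables (U : int -> lmodType K) (B : gcalgType K).
Variables (n : nat) (d : 'I_n -> int).

Lemma homog_prod (A : gcalgType K) (a : 'I_n -> A) (X : {set 'I_n}) :
  (forall i, homog (d i) (a i)) -> homog (wt d X) (\prod_(i in X) a i).
Proof.
move=> ah; rewrite /wt prodr_enum -big_enum; elim: (enum X) => [|i s IH].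
  by rewrite !big_nil; exact: homog1.
by rewrite !big_cons; exact: homogM.
Qed.

(** If a i0 = 1 then G is unchanged when i0 is removed from its argument, so
    rho i0 G is the symbol of i0 times G.  By uniqueness the derivative at i0 of
    the logarithm is this symbol, which lives on the singleton of i0. *)
Lemma cumulant_unit (A : gcalgType K) (f : A -> pser B) (a : 'I_n -> A)
  (i0 : 'I_n) :
  hom0 k f -> f 1 = 1 -> (1 < n)%N ->
  (forall i, homog (d i) (a i)) -> a i0 = 1 -> d i0 = 0 ->
  cumulant (text f) d (fun i => pconst (a i)) = 0.
Proof.
move=> [flin fh] f1 n1 ah a1 d0.
have Gh X : pser_homog k (wt d X) (f (\prod_(i in X) a i)).
  by apply: fh; exact: homog_prod.
pose G : setfun kodd B d := SetFun kodd Gh.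
have GE X : G X = f (\prod_(i in X) a i) by [].
have G0 : G set0 = 1 by rewrite GE big_set0.
have oddz_d i : oddz (d i) = oddz (wt d (id @^-1: [set i])).
  by rewrite preimset_id /wt big_set1.
have idK : cancel (@id 'I_n) id by [].
have Gc := block_logP idK G0; set c := block_log _ _ in Gc.
rewrite (@cumulant_log _ _ id id (fun _ _ => id) idK d d oddz_d _ _ _ _ G
  G0 _ _ _ c) //;
  last 2 first.
- by apply: ltn_trans n1.
- by move=> X; rewrite pconst_prod text_pconst // preimset_id.
rewrite restr_saturated_id in Gc.
pose delta := restr (pred1 [set i0]) G.
have odd0 : oddz (d i0) = false by rewrite d0.
have rG : rho i0 G = delta * G.
  apply: setfunP => X; rewrite rhoE setfunM; case: ifP => i0X; last first.
    rewrite big1 // => Y /subsetP sY; rewrite restrE /=; case: eqP => [YE|_].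
      by have := sY i0; rewrite YE inE eqxx i0X => /(_ erefl).
    by rewrite mul0r scaler0.
  rewrite (bigD1 [set i0]) ?sub1set //= [X in _ + X]big1 =>
    [|Y /andP[_ /negPf ->]].
    rewrite eqxx addr0 big_set1 a1 f1 mul1r.
    have -> : shuffle_par d [set i0] (X :\ i0) = false.
      by rewrite /shuffle_par big_set1 big1 // => z _;
        rewrite /inversion_par odd0 andbF.
    rewrite scale1r; congr f.
    rewrite (prodr_enum (X :\ i0)) prodr_enum.
    have -> : enum (X :\ i0) = [seq i <- enum X | i != i0].
      rewrite filter_enum; have -> // : X :\ i0 = [set i in X | i != i0].
      by apply/setP => i; rewrite !inE andbC.
    rewrite [RHS]big_filter [RHS]big_mkcond; apply: eq_bigr => i _.
    by case: eqP => [->|].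
  by rewrite mul0r scaler0.
have := congr1 (fun g : setfun kodd B d => g setT) (log_rho_uniq Gc rG).
rewrite rhoE inE => ->; rewrite restrE /=; case: eqP => // T1.
by have := congr1 (fun X : {set 'I_n} => #|X|) T1;
  rewrite cardsT card_ord cards1; lia.
Qed.

(** The logarithm on the letters of all the words satisfies the bound by
    hypothesis.  Gluing every letter to the chosen letter of its word leaves the
    n chosen letters as the only ones with positive weight. *)
Lemma cumulant_words (phi : symalg U -> pser B) (ws : 'I_n -> seq (letter U)) :
  [pchar K] =i pred0 -> hom0 k phi -> phi 1 = 0 ->
  (forall w, tmod0 (size w).-1 (phi (sprod w))) -> (0 < n)%N ->
  (forall i, wdeg (ws i) = d i) -> (forall i, (0 < size (ws i))%N) ->
  tmod0 n.-1
    (cumulant (text (exp_star phi)) d (fun i => pconst (sprod (ws i)))).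
Proof.
move=> charK hphi phi1 phiv n0 wsd ws0.
(* Each letter carries the index of its word, so that p is a projection. *)
pose V : seq ('I_n * letter U) :=
  flatten [seq [seq (i, l) | l <- ws i] | i <- enum 'I_n].
pose N := size V; pose T := tnth (in_tuple V).
pose p (j : 'I_N) := (T j).1; pose W (j : 'I_N) := (T j).2.
have hE := hom0_exp_star phi1 hphi.
have Elin : linear (exp_star phi) by case: hE.
have p_mono : forall x y : 'I_N, (x <= y)%N -> (p x <= p y)%N.
  have pV : pairwise (fun u v : 'I_n * letter U => u.1 <= v.1)%N V.
    rewrite /V; have : pairwise (fun i j : 'I_n => i < j)%N (enum 'I_n).
      have -> : enum 'I_n = enum [set: 'I_n] by rewrite enum_setT enumT.
      exact: enum_pairwise.
    elim: (enum 'I_n) => //= i r IH /andP[/allP ir /IH pr].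
    rewrite pairwise_cat pr andbT; apply/andP; split.
      apply/allrelP => u v /mapP[l _ ->] /flatten_mapP[j /ir ij /mapP[l' _ ->]]
        /=.
      exact: ltnW.
    by rewrite pairwise_map; elim: (ws i) => //= l r' ->; rewrite andbT;
      apply/allP => ? _ /=.
  move=> x y; rewrite leq_eqVlt => /orP[/eqP/val_inj -> //|xy].
  rewrite /p /T !(tnth_nth (T x)) /=.
  exact: (pairwiseP (T x) pV) (ltn_ord x) (ltn_ord y) xy.
have p_surj i : exists j, p j = i.
  case E : (ws i) (ws0 i) => [|l r] // _.
  have /tnthP[j jE] : (i, l) \in in_tuple V.
    apply/flatten_mapP; exists i; first by rewrite mem_enum.
    by rewrite map_f // E inE eqxx.
  by exists j; rewrite /p /T -jE.
have [s sK] : exists s, cancel s p by have [s sP] := choice p_surj; exists s.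
have subE (X : {set 'I_n}) : subword W (p @^-1: X) =
  flatten [seq ws i | i <- enum X].
  rewrite /subword;
    have -> : enum (p @^-1: X) = [seq j <- enum [set: 'I_N] | (T j).1 \in X].
    rewrite filter_enum;
      have -> // : p @^-1: X = [set j in setT | (T j).1 \in X].
    by apply/setP => j; rewrite !inE.
  have -> : enum X = [seq i <- enum [set: 'I_n] | i \in X].
    rewrite filter_enum;
      have <- // : X = [set i in setT | i \in X] by apply/setP => i;
        rewrite !inE.
  rewrite (map_comp snd T) -(filter_map T (fun v => v.1 \in X)).
  rewrite !enum_setT -!enumT map_tnth_enum /= /V.
  elim: (enum 'I_n) => //= i r IH;
    rewrite filter_cat map_cat IH filter_map -map_comp.
  rewrite (@eq_filter _ _ (fun=> i \in X)) //.
  by case: (i \in X);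
    rewrite ?filter_predT ?filter_pred0 //= -[in RHS](map_id (ws i)).
pose G := hat W kodd hE; pose c := hat W kodd hphi.
have Gc : is_log G c by exact: exp_star_log.
have G0 : G set0 = 1 by case: Gc.
have oddz_d i : oddz (d i) = oddz (wt (ldeg W) (p @^-1: [set i])).
  by rewrite -wdeg_subword subE enum_set1 /= cats0 wsd.
have [|c' c'G c'v] := @merge_list _ _ _ _ _ _ (fun b => s (p b)) G c
  [seq b <- enum 'I_N | b != s (p b)] Gc _ (filter_uniq _ (enum_uniq _)).
  by move=> X; rewrite hatE -(size_subword W X); exact: phiv.
rewrite (@cumulant_log _ _ p s p_mono sK _ _ oddz_d _ _ _ _ G G0 _ _ _ c') //.
- suff nE : #|[set x in setT | x \notin [seq b <- enum 'I_N | b != s (p b)]]| =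
  n.
    by have := c'v setT; rewrite nE.
  rewrite -[RHS]card_ord -cardsT -(card_imset _ (can_inj sK)).
  congr #|pred_of_set _|; apply/setP => x.
  rewrite !inE mem_filter mem_enum andbT negbK.
  apply/eqP/imsetP => [->|[i _ ->]]; first by exists (p x).
  by rewrite sK.
- by move=> X; rewrite pconst_prod text_pconst // sprod_flatten hatE subE.
suff <- : restr (fun X => all (fun b => (s (p b) \in X) == (b \in X))
    [seq b <- enum 'I_N | b != s (p b)]) G = restr (saturated p s) G by [].
apply: setfunP => X; rewrite !restrE; congr (if _ then _ else _).
apply/allP/eqP => [sat|sat b _].
  apply/setP => b; rewrite !inE; case: (b =P s (p b)) => [<- //|/eqP nb].
  by have := sat b; rewrite mem_filter mem_enum nb => /(_ erefl)/eqP.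
by rewrite [in X in _ == X]sat !inE.
Qed.
End Words.

(** * The equivalence of the two notions of morphism *)
Theorem proposition2p13 (K : fieldType) (charK : [pchar K] =i pred0)
    (k : int) (kodd : odd `|k|%N) (U : int -> lmodType K) (B : gcalgType K)
    (D : derivedBV k (symalg U)) (D' : derivedBV k B)
    (phi : symalg U -> pser B) (phi_hom : hom0 k phi) (phi1 : phi 1 = 0) :
  CL_morphism D D' phi <-> BV_morphism D D' (text (exp_star phi)).
Proof.
have hE := hom0_exp_star phi1 phi_hom.
have [Elin Eh] := hE; have [plin _] := phi_hom.
have E1 : exp_star phi 1 = 1 by exact: exp_star1.
split=> [[_ _ comm van]|[_ _ _ comm kap]]; split=> //.
- exact: text_tlinear.
- exact: text_homog.
- by rewrite (text_pconst Elin 1).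
- move=> n d a n2 ah.
  have affine a' j c x y : cumulant (text (exp_star phi)) d
        (fun i => pconst (update a' j (c *: x + y) i)) =
      c *: cumulant (text (exp_star phi)) d
        (fun i => pconst (update a' j x i)) +
      cumulant (text (exp_star phi)) d (fun i => pconst (update a' j y i)).
    apply: (@cumulant_affine _ _ _ _ _ _ j); first exact: text_linear.
    - by move=> i /negPf ij; rewrite /update ij.
    - by move=> i /negPf ij; rewrite /update ij.
    rewrite /update eqxx; apply/funext => m; rewrite pserD pserZ.
    by case: m => [|m] //=; rewrite scaler0 addr0.
  apply: (multilinear_words (Q := fun a => tmod0 n.-1
    (cumulant (text (exp_star phi)) d (fun i => pconst (a i))))) ah
      => [a' j|a' j c x y hx hy|ws wsd].
  + have := affine a' j 1 0 0; rewrite !scale1r addr0 => /eqP.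
    by rewrite -subr_eq subrr eq_sym => /eqP ->.
  + by rewrite affine; apply: tmod0D => //; exact: tmod0Z.
  have [ws0|/existsNP[i0 /negP]] := pselect (forall i, (0 < size (ws i))%N).
    apply: (cumulant_words kodd) => //; last exact: ltn_trans n2.
    move=> w i iw; apply: van; apply: sspan_sprod => /=; lia.
  rewrite -leqNgt leqn0 size_eq0 => /eqP wsi0.
  rewrite (cumulant_unit kodd (i0 := i0) hE E1 n2) //.
  + by move=> i; rewrite -wsd; exact: homog_sprod.
  + by rewrite wsi0 sprod_nil.
  by rewrite -wsd wsi0 /wdeg big_nil.
move=> n x; elim/sspan_ind: x / => [|c w x /= nw IH].
  by rewrite (linear_fun0 plin).
rewrite plin pserD pserZ IH addr0.
have w0 : (0 < size w)%N by lia.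
rewrite -(cumulant_letters kodd charK phi_hom phi1 w0) kap ?scaler0 //; try lia.
by move=> i; exact: homog_letter.
Qed.
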